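(* Let $\epsilon$ be a nonnegative real number with $\epsilon<1.197\cdot 10^{-5}$. Let $G$ be a finite simple tripartite graph with tripartition $(V_1,V_2,V_3)$ such that (i) $|V_1|=|V_2|=|V_3|=n$; (ii) for every $i\in\{1,2,3\}$ and every vertex $v\in V_i$, $\deg_+(v)=\deg_-(v)\ge(1-\epsilon)n$. Then $G$ admits a triangle decomposition.
   Context: For a tripartite graph with parts $V_1,V_2,V_3$ (indices taken modulo $3$) and $v\in V_i$, $\deg_+(v)$ denotes the number of neighbors of $v$ in $V_{i+1}$ and $\deg_-(v)$ the number of neighbors of $v$ in $V_{i-1}$. A triangle decomposition of $G$ is a collection of subgraphs of $G$, each a triangle (copy of $K_3$), whose edge sets partition $E(G)$. *)

(* Defs.v *)
From mathcomp Require Import all_boot all_order all_algebra.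
From mathcomp Require Import reals.

Set Implicit Arguments.
Unset Strict Implicit.
Unset Printing Implicit Defensive.

Import GRing.Theory Num.Theory.
Local Open Scope ring_scope.

(* A finite simple graph is a symmetric irreflexive adjacency relation
   e : rel T on a finite vertex type T; an edge is the set of its two
   endpoints. *)
Definition edges (T : finType) (e : rel T) : {set {set T}} :=
  [set [set p.1; p.2] | p in [set p : T * T | e p.1 p.2]].

(* Parts may be empty, unlike the blocks of [partition]. *)
Definition tripartition (T : finType) (e : rel T) (V : 'I_3 -> {set T}) : Prop :=
  [/\ \bigcup_(i < 3) V i = [set: T],
      forall i j : 'I_3, i != j -> [disjoint V i & V j]
    & forall (i : 'I_3) (x y : T), x \in V i -> y \in V i -> ~~ e x y].

Definition deg_in (T : finType) (e : rel T) (A : {set T}) (v : T) : nat :=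
  #|[set w in A | e v w]|.

(* For i : 'I_3, the ring operations i + 1 and i - 1 are modulo 3. *)
Definition deg_plus (T : finType) (e : rel T) (V : 'I_3 -> {set T})
    (i : 'I_3) (v : T) : nat := deg_in e (V (i + 1)) v.

Definition deg_minus (T : finType) (e : rel T) (V : 'I_3 -> {set T})
    (i : 'I_3) (v : T) : nat := deg_in e (V (i - 1)) v.

(* A subgraph isomorphic to K_3 is determined by its vertex set, so triangles
   are represented by the sets of three pairwise adjacent vertices. *)
Definition triangle (T : finType) (e : rel T) (A : {set T}) : Prop :=
  #|A| = 3%N /\ {in A &, forall x y : T, x != y -> e x y}.

Definition triangle_edges (T : finType) (A : {set T}) : {set {set T}} :=
  [set B : {set T} | (B \subset A) && (#|B| == 2%N)].

(* Distinct triangles have distinct edge sets, so passing to the set of edge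
   sets does not identify members of D. *)
Definition triangle_decomposition (T : finType) (e : rel T)
    (D : {set {set T}}) : Prop :=
  (forall A : {set T}, A \in D -> triangle e A) /\
  partition [set triangle_edges A | A in D] (edges e).

(* Main.v *)
(* Label the three parts by a dihedral group of order n = 2m. The triples with
   u v w = 1 form a Latin square L, that is, a triangle decomposition of
   K_{n,n,n}. If u v w is a reflection then (u v w)^2 = 1, and this says that the
   three L-triangles on the edges of the triangle T = (u, v, w) are completed by
   a fourth one to a decomposition of the octahedron on their six vertices. The
   octahedron is also the union of T and three other triangles, so four
   L-triangles can be traded for three triangles and the edges of T. Thus T can
   be subtracted from a decomposition as long as its four L-triangles are unused,
   while adding a triangle is always possible; only the signed sum of all
   triangles matters, since a family of triangles covering each edge of G exactly
   once and no other edge is a decomposition.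

   Let H be the tripartite complement of G. Remove from L every triangle meeting H;
   the edges R of these triangles outside H form a balanced graph, to be written
   as a signed sum of triangles. Walk along R: a path s -> t whose edges have
   been replaced by the two edges from an apex a to s and t (with a negative
   sign) is extended to r -> s -> t -> p -> q, with a new apex c, by means of
   freely chosen vertices b and c, at the cost of three subtracted triangles. A
   counting argument keeps every vertex in few used L-triangles, so that b and c
   exist. For this no vertex may lie in many L-triangles opposite to edges of H,
   which a second moment computation gives for a random labelling of the parts.
   If n is odd, first cover by triangles all the edges at one vertex of each
   part. *)
Require Import Defs.
From mathcomp Require Import all_boot all_order all_algebra all_fingroup.
From mathcomp Require Import reals.
From mathcomp Require Import zify lra.

Set Implicit Arguments.
Unset Strict Implicit.
Unset Printing Implicit Defensive.

(** * Tripartite multigraphs *)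

(* Locked, lest unification try to compute in 'I_3. *)
Definition nx : 'I_3 -> 'I_3 := locked (fun i => i + 1)%R.

Lemma nxE i : nx i = (i + 1)%R.
Proof. by rewrite /nx -lock. Qed.

Lemma nx3 i : nx (nx (nx i)) = i.
Proof. by rewrite !nxE; apply/val_inj; case: i => [[|[|[|?]]] ?]. Qed.

Lemma nx_neq i : ((nx i == i) = false) * ((i == nx i) = false)
  * ((nx (nx i) == i) = false) * ((i == nx (nx i)) = false)
  * ((nx (nx i) == nx i) = false) * ((nx i == nx (nx i)) = false).
Proof. by rewrite !nxE; do !split; case: i => [[|[|[|?]]] ?]. Qed.

Lemma nx_inj : injective nx.
Proof. by move=> i j /(congr1 (fun k => nx (nx k))); rewrite !nx3. Qed.

Variant nx_spec (i : 'I_3) : 'I_3 -> Type :=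
  | Nx0 : nx_spec i i
  | Nx1 : nx_spec i (nx i)
  | Nx2 : nx_spec i (nx (nx i)).

Lemma nxP i j : nx_spec i j.
Proof.
have [->|ne0] := eqVneq j i; first exact: Nx0.
have [->|ne1] := eqVneq j (nx i); first exact: Nx1.
have -> : j = nx (nx i).
  by apply/val_inj; move: ne0 ne1; rewrite !nxE; case: i => [[|[|[|?]]] ?];
     case: j => [[|[|[|?]]] ?].
exact: Nx2.
Qed.

(* (i, u, v) is the edge joining u in part i to v in part i + 1. *)
Notation edge A := ('I_3 * A * A)%type.
(* (i, u, v, w) is the triangle with u, v, w in the parts i, i + 1, i + 2;
   rotations of a triangle are not identified. *)
Notation tri A := ('I_3 * A * A * A)%type.

Section Cover.
Variable A : finType.
Implicit Types (i j : 'I_3) (e : edge A) (mu : edge A -> nat).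

Definition bdry (T : tri A) e : nat :=
  let: (i, u, v, w) := T in
  (e == (i, u, v)) + (e == (nx i, v, w)) + (e == (nx (nx i), w, u)).

Definition cov (D : seq (tri A)) e : nat := \sum_(T <- D) bdry T e.

Lemma cov_nil e : cov [::] e = 0. Proof. by rewrite /cov big_nil. Qed.
Lemma cov_cons T D e : cov (T :: D) e = bdry T e + cov D e.
Proof. by rewrite /cov big_cons. Qed.
Lemma cov_cat D D' e : cov (D ++ D') e = cov D e + cov D' e.
Proof. by rewrite /cov big_cat. Qed.

Definition outd mu i v := \sum_w mu (i, v, w).
(* The in-degree of v, as a vertex of part i + 1. *)
Definition ind mu i v := \sum_u mu (i, u, v).
(** This is the condition deg_+ = deg_- : both sides concern the vertex [v] of part [nx i]. *)
Definition balanced mu := forall i v, ind mu i v = outd mu (nx i) v.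
Definition weight mu := \sum_e mu e.

Definition unit_edge e0 e : nat := e == e0.

Lemma outd_unit i u v j x : outd (unit_edge (i, u, v)) j x = ((j, x) == (i, u)).
Proof.
rewrite /outd /unit_edge; under eq_bigr do rewrite -pair_eqE /= -/(_ == _).
case: ((j, x) == (i, u)); rewrite /=; last by rewrite big1.
rewrite (bigD1 v) //= eqxx big1 ?addn0 // => w /negbTE->//.
Qed.

Lemma ind_unit i u v j x : ind (unit_edge (i, u, v)) j x = ((j, x) == (i, v)).
Proof.
rewrite /ind /unit_edge; under eq_bigr => w do rewrite !xpair_eqE andbAC.
rewrite xpair_eqE; case: ((j == i) && (x == v)); last by rewrite big1.
by rewrite (bigD1 u) //= eqxx big1 ?addn0 // => w /negbTE->.
Qed.

Lemma weight_unit e0 : weight (unit_edge e0) = 1.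
Proof.
by rewrite /weight (bigD1 e0) //= {1}/unit_edge eqxx big1 // => e /negbTE h;
   rewrite /unit_edge h.
Qed.

Lemma outdD mu1 mu2 mu : (forall e, mu e = mu1 e + mu2 e) ->
  forall i v, outd mu i v = outd mu1 i v + outd mu2 i v.
Proof. by move=> h i v; rewrite /outd; under eq_bigr do rewrite h; rewrite big_split. Qed.

Lemma indD mu1 mu2 mu : (forall e, mu e = mu1 e + mu2 e) ->
  forall i v, ind mu i v = ind mu1 i v + ind mu2 i v.
Proof. by move=> h i v; rewrite /ind; under eq_bigr do rewrite h; rewrite big_split. Qed.

Lemma weightD mu1 mu2 mu : (forall e, mu e = mu1 e + mu2 e) -> weight mu = weight mu1 + weight mu2.
Proof. by move=> h; rewrite /weight; under eq_bigr do rewrite h; rewrite big_split. Qed.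

Lemma outd_gt0 mu i v : 0 < outd mu i v -> exists w, 0 < mu (i, v, w).
Proof.
move=> h; have [w hw|h0] := pickP (fun w => 0 < mu (i, v, w)); first by exists w.
by move: h; rewrite /outd big1 // => w _; apply/eqP; rewrite -leqn0 leqNgt h0.
Qed.

Lemma ind_gt0 mu i v : 0 < ind mu i v -> exists u, 0 < mu (i, u, v).
Proof.
move=> h; have [w hw|h0] := pickP (fun w => 0 < mu (i, w, v)); first by exists w.
by move: h; rewrite /ind big1 // => w _; apply/eqP; rewrite -leqn0 leqNgt h0.
Qed.

Lemma weight_gt0 mu : 0 < weight mu -> exists e, 0 < mu e.
Proof.
move=> h; have [w hw|h0] := pickP (fun w => 0 < mu w); first by exists w.
by move: h; rewrite /weight big1 // => w _; apply/eqP; rewrite -leqn0 leqNgt h0.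
Qed.

Definition decr mu e0 e : nat := mu e - unit_edge e0 e.

Lemma decrE mu e0 : 0 < mu e0 -> forall e, mu e = decr mu e0 e + unit_edge e0 e.
Proof. by move=> h e; rewrite /decr /unit_edge; case: eqP => [->|_] /=; lia. Qed.

(** [H] holds the missing edges; the graph decomposed is its tripartite complement. *)
Definition decomposable (H : {set edge A}) :=
  exists D, forall e, cov D e = (e \notin H).

End Cover.

(** * The dihedral Latin square *)

(* If the third vertex of a triangle is a function th of its first two vertices,
   invariance under rotations makes these triangles a Latin square. *)
Definition semisymmetric (A : Type) (th : A -> A -> A) := forall u v, th v (th u v) = u.

Section Semisymmetric.
Variables (A : finType) (th : A -> A -> A).
Hypothesis thC : semisymmetric th.
Implicit Types (i j : 'I_3) (u v w x y : A) (U : {set edge A}).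

Lemma thCC u v : th (th u v) u = v.
Proof. by rewrite -{2}(thC u v) thC. Qed.

Lemma th_injr u : injective (th u).
Proof. by move=> v w h; rewrite -(thCC u v) h thCC. Qed.

Lemma th_injl v : injective (th^~ v).
Proof. by move=> u w /= h; rewrite -(thC u v) h thC. Qed.

(** The next edge of the Latin square triangle through [e]. Thus [rot_closed U] says that [U] is a
    union of edge sets of such triangles. *)
Definition rot e : edge A := let: (i, u, v) := e in (nx i, v, th u v).

Definition rot_closed U := forall e, e \in U -> rot e \in U.

Lemma rot3 e : rot (rot (rot e)) = e.
Proof. by case: e => [[i u] v]; rewrite /rot nx3 thC thCC. Qed.

Lemma rot_closedE U e : rot_closed U -> (rot e \in U) = (e \in U).
Proof.
move=> cU; have [h|h] := boolP (e \in U); first by rewrite cU.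
by apply/negP => h'; case/negP: h; rewrite -(rot3 e); apply/(cU _)/(cU _).
Qed.

Lemma rotE U i u v : rot_closed U -> ((nx i, v, th u v) \in U) = ((i, u, v) \in U).
Proof. exact: (@rot_closedE U (i, u, v)). Qed.

Lemma rotVE U i u v : rot_closed U ->
  ((i, u, v) \in U) = ((nx (nx i), th u v, u) \in U).
Proof. 
by move/(@rot_closedE U (nx (nx i), th u v, u)); rewrite /rot nx3 thCC.
Qed.

(** Every edge lies in exactly one Latin square triangle, listed by its edge leaving part 0; each
    triangle is inside or outside [U] as a whole. *)
Lemma cov_latin U : rot_closed U -> exists D, forall e : edge A, cov D e = (e \notin U).
Proof.
move=> cU; pose o : 'I_3 := ord0.
exists [seq (o, p.1, p.2, th p.1 p.2) | p <- enum [set p : A * A | (o, p.1, p.2) \notin U]].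
move=> e; rewrite /cov big_map big_enum /=.
(* (x, y) is the edge leaving part 0 of the Latin square triangle through [e]. *)
have [x [y [hU he]]] : exists x y, ((o, x, y) \in U) = (e \in U) /\
    forall p : A * A, bdry (o, p.1, p.2, th p.1 p.2) e = (p == (x, y)).
  case: e => [[j u] v]; case: (nxP o j).
  - exists u, v; split=> // -[x y] /=.
    by rewrite /bdry !xpair_eqE !nx_neq eqxx !addn0 /= [x == u]eq_sym [y == v]eq_sym.
  - exists (th u v), u; split=> [|[x y]] /=.
      by rewrite -[LHS](rotE _ _ _ cU) thCC.
    rewrite /bdry !xpair_eqE !nx_neq eqxx !addn0 /=; congr nat_of_bool.
    apply/andP/andP => -[/eqP-> /eqP->]; first by rewrite thC !eqxx.
    by rewrite thCC !eqxx.
  - exists v, (th u v); split=> [|[x y]] /=.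
      by rewrite -[RHS](rotE _ _ _ cU) nx3.
    rewrite /bdry !xpair_eqE !nx_neq eqxx /=; congr nat_of_bool.
    apply/andP/andP => -[/eqP-> /eqP->]; first by rewrite thCC !eqxx.
    by rewrite thC !eqxx.
rewrite (eq_bigr (fun p : A * A => (p == (x, y)) : nat)); last by move=> p _; exact: he.
rewrite (eq_bigl (fun p : A * A => (o, p.1, p.2) \notin U)); last by move=> p; rewrite inE.
rewrite -hU; have [xU|xU] := boolP ((o, x, y) \in U).
  rewrite big1 // => -[x' y'] /=; have [[-> ->]|//] := eqVneq (x', y') (x, y).
  by rewrite xU.
by rewrite (bigD1 (x, y)) //= eqxx big1 // => p /andP[_ /negbTE->].
Qed.

End Semisymmetric.

(* In the dihedral group, with the rotations coloured by false and
   th u v = (u v)^-1, thO says that (u v w)^2 = 1 for every reflection u v w. *)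
Record dihedral_square (A : finType) (tau : A -> bool) (th : A -> A -> A) : Prop :=
  DihedralSquare {
    thC :> semisymmetric th;
    thT : forall u v, tau (th u v) = tau u (+) tau v;
    thO : forall u v w, tau u (+) tau v (+) tau w ->
      th (th v w) (th w u) = th u v }.

(** * Octahedra and triangles as units of trading *)

Section Blocks.
Variables (A : finType) (tau : A -> bool) (th : A -> A -> A).
Hypothesis dih : dihedral_square tau th.
Implicit Types (i j : 'I_3) (u v w x y : A) (U : {set edge A}).

Let thC := thC dih.
Let thT := thT dih.
Let thO := thO dih.
Let thCC := thCC dih.
Let rotE := rotE dih.
Let rotVE := rotVE dih.

Definition clique (P : 'I_3 -> pred A) : {set edge A} :=
  [set e | P e.1.1 e.1.2 && P (nx e.1.1) e.2].

Lemma in_clique P i u v : ((i, u, v) \in clique P) = P i u && P (nx i) v.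
Proof. by rewrite inE. Qed.

(* The triangle T may be traded away at the cost of the Latin square triangles
   contained in P. *)
Record block (P : 'I_3 -> pred A) (T : tri A) : Prop := Block {
  block_rot : rot_closed th (clique P);
  block_tau : forall i x y, P i x -> P i y -> tau x = tau y -> x = y;
  block_cov : exists X, forall e, e \in clique P = bdry T e + cov X e :> nat }.

(** The second vertex of each part completes the opposite edge of (u, v, w) to a Latin square
    triangle. *)
Definition octa i u v w : 'I_3 -> pred A := fun j x =>
  [|| (j == i) && ((x == u) || (x == th v w)),
      (j == nx i) && ((x == v) || (x == th w u))
    | (j == nx (nx i)) && ((x == w) || (x == th u v))].

Definition tria i u v w : 'I_3 -> pred A := fun j x =>
  [|| (j == i) && (x == u), (j == nx i) && (x == v) | (j == nx (nx i)) && (x == w)].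

Lemma octaE i u v w :
  (octa i u v w i =1 pred2 u (th v w)) *
  (octa i u v w (nx i) =1 pred2 v (th w u)) *
  (octa i u v w (nx (nx i)) =1 pred2 w (th u v)).
Proof. by rewrite /octa; split; [split|] => x; rewrite !nx_neq !eqxx /= ?orbF. Qed.

Lemma triaE i u v w :
  (tria i u v w i =1 pred1 u) * (tria i u v w (nx i) =1 pred1 v) *
  (tria i u v w (nx (nx i)) =1 pred1 w).
Proof. by rewrite /tria; split; [split|] => x; rewrite !nx_neq !eqxx /= ?orbF. Qed.

Lemma odd_neq u v w : tau u (+) tau v (+) tau w -> (w == th u v) = false.
Proof. by move=> h; apply/eqP => e; move: h; rewrite e thT addbb. Qed.

(** The eight faces of the octahedron form two decompositions of it. One consists of Latin square
    triangles, the fourth of them by [thO]; the other is (u, v, w) with the three triangles given as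
    witness. Oddness gives the two vertices of a part different colours. *)
Lemma octa_block i u v w : tau u (+) tau v (+) tau w ->
  block (octa i u v w) (i, u, v, w).
Proof.
move=> odd; have odd1 : tau v (+) tau w (+) tau u by rewrite addbC addbA.
have odd2 : tau w (+) tau u (+) tau v by rewrite addbC addbA.
split.
- case=> [[j x] y]; rewrite /rot !in_clique.
  by case: (nxP i j); rewrite ?nx3 !octaE /= => /andP[/pred2P[]-> /pred2P[]->];
    rewrite ?eqxx ?thC ?thCC ?thO ?eqxx ?orbT.
- move=> j x y; case: (nxP i j); rewrite !octaE /= => /pred2P[]-> /pred2P[]-> //;
  rewrite thT => h; exfalso; move: odd h;
  by case: (tau u) (tau v) (tau w) => [] [] [].
exists [:: (i, u, th w u, th u v); (i, th v w, v, th u v); (i, th v w, th w u, w)].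
case=> [[j x] y]; rewrite !cov_cons cov_nil addn0 in_clique /bdry !xpair_eqE.
have := (odd_neq odd, odd_neq odd1, odd_neq odd2) => -[[n1 n2] n3].
have N (a b : A) z : (a == b) = false -> ~~ ((z == a) && (z == b)).
  by move=> h; apply/negP => /andP[/eqP-> /eqP/eqP]; rewrite h.
case: (nxP i j); rewrite ?nx3 ?octaE !nx_neq !eqxx !(andbF, andbT, andFb, andTb, addn0, add0n) /=.
- by have := N _ _ x n2; have := N _ _ y n3; do 4!case: (_ == _).
- by have := N _ _ x n3; have := N _ _ y n1; do 4!case: (_ == _).
- by have := N _ _ x n1; have := N _ _ y n2; do 4!case: (_ == _).
Qed.

(** A Latin square triangle is subtracted by deleting it, with nothing put in its place. *)
Lemma tria_block i u v w : th u v = w -> block (tria i u v w) (i, u, v, w).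
Proof.
move=> <-; split.
- case=> [[j x] y]; rewrite /rot !in_clique.
  by case: (nxP i j); rewrite ?nx3 !triaE /= => /andP[/eqP-> /eqP->];
    rewrite ?eqxx ?thC ?thCC ?eqxx.
- by move=> j x y; case: (nxP i j); rewrite !triaE /= => /eqP-> /eqP->.
exists [::] => -[[j x] y]; rewrite cov_nil addn0 in_clique /bdry !xpair_eqE.
by case: (nxP i j); rewrite ?nx3 ?triaE !nx_neq !eqxx ?addn0.
Qed.

Lemma tria_free i u v w U : rot_closed th U -> th u v = w -> (i, u, v) \notin U ->
  [disjoint clique (tria i u v w) & U].
Proof.
move=> cU <- n1; rewrite disjoint_subset; apply/subsetP => -[[j x] y].
rewrite in_clique inE.
case: (nxP i j); rewrite ?nx3 !triaE /= => /andP[/eqP-> /eqP->] //.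
  by rewrite rotE.
by rewrite -rotVE.
Qed.

(** Since [U] is a union of Latin square triangles, testing one edge of each of the four in the
    octahedron suffices; the others are rotations. *)
Lemma octa_free i u v w U : rot_closed th U -> tau u (+) tau v (+) tau w ->
  (i, u, v) \notin U -> (nx i, v, w) \notin U -> (nx (nx i), w, u) \notin U ->
  (i, th v w, th w u) \notin U -> [disjoint clique (octa i u v w) & U].
Proof.
move=> cU odd n1 n2 n3 n4; rewrite disjoint_subset; apply/subsetP => -[[j x] y].
rewrite in_clique inE => h.
have odd1 : tau v (+) tau w (+) tau u by rewrite addbC addbA.
have odd2 : tau w (+) tau u (+) tau v by rewrite addbC addbA.
have R1 a b : ((nx i, b, th a b) \in U) = ((i, a, b) \in U) by rewrite rotE.
have R2 a b : ((nx (nx i), th a b, a) \in U) = ((i, a, b) \in U) by rewrite -rotVE.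
have R3 a b : ((nx (nx i), b, th a b) \in U) = ((nx i, a, b) \in U) by rewrite rotE.
have R4 a b : ((i, th a b, a) \in U) = ((nx i, a, b) \in U).
  by rewrite [in RHS]rotVE // nx3.
have R5 a b : ((i, b, th a b) \in U) = ((nx (nx i), a, b) \in U).
  by rewrite -[in RHS]rotE // nx3.
have R6 a b : ((nx i, th a b, a) \in U) = ((nx (nx i), a, b) \in U).
  by rewrite [in RHS]rotVE // nx3.
move: h; case: (nxP i j); rewrite ?nx3 !octaE /= => /andP[/pred2P[]-> /pred2P[]->] //;
 do ?[by rewrite R1 | by rewrite R2 | by rewrite R3 | by rewrite R4 | by rewrite R5 | by rewrite R6].
- by rewrite -(thO odd) R1.
- by rewrite -(thO odd) R2.
Qed.

End Blocks.

(** * Absorbing the leave *)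

Section Absorb.
Variables (A : finType) (tau : A -> bool) (th : A -> A -> A).
Hypothesis dih : dihedral_square tau th.
(** [m] is the size of a colour class, [theta] the load from which new vertices are avoided, [w] a
    bound on the number of such vertices in a part, [d0] a degree bound, and [M] bounds the total
    load of a part plus twice the number of edges left. *)
Variables (m theta w d0 M : nat).
Hypothesis tau_card : forall k, #|[set x | tau x == k]| = m.
Hypothesis M_lt : M < theta * w.+1.
Let B0 := theta + d0 + 6.
Hypothesis m_gt : 9 * B0 + 8 * w + 6 < m.
Variable H : {set edge A}.

Implicit Types (i j : 'I_3) (u v x y : A) (U : {set edge A}).

Let thC := thC dih.
Let thT := thT dih.
Let thO := thO dih.
Let thCC := thCC dih.
Let th_injr := th_injr dih.
Let th_injl := th_injl dih.

(* The edges of Latin square triangles used so far form U, and mu is what is left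
   of the leave; pos holds the edges still covered twice. Every trade adds 1 to
   the load ld of its vertices; ld bounds the number of used triangles on a vertex
   for each colour of one of their other vertices, since an octahedron has one of
   each colour. *)
Record state U (ld : 'I_3 -> A -> nat) (D : seq (tri A)) (mu pos Q : edge A -> nat) :=
  State {
    st_rot : rot_closed th U;
    st_half : forall j u k, #|[set v | (tau v == k) && ((j, u, v) \in U)]| <= ld j u;
    st_sub : forall e, 0 < mu e -> e \in U;
    st_cov : forall e, (e \notin U) + cov D e + (e \in H) + mu e = 1 + pos e;
    st_bal : balanced Q;
    st_out : forall j v, outd Q j v <= d0;
    st_ld : forall j v, ld j v + outd Q j v <= B0;
    st_sum : forall j, \sum_v ld j v + 2 * weight Q <= M }.

Definition closed_state U ld D mu := state U ld D mu (fun=> 0) mu.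

(* The edges of a path from s to t have been replaced, with a negative sign, by
   the edges from the apex a, which are therefore covered twice; in Q they count
   as a single edge (s, t). *)
Record open_state i s t a U ld D mu := OpenState {
  os_st : state U ld D mu
    (fun e => unit_edge (nx i, t, a) e + unit_edge (nx (nx i), a, s) e)
    (fun e => mu e + unit_edge (i, s, t) e);
  os_ta : (nx i, t, a) \notin U;
  os_as : (nx (nx i), a, s) \notin U;
  os_neq : s != th t a;
  os_a : ld (nx (nx i)) a <= theta + 3;
  os_ta' : ld i (th t a) <= theta + 3;
  os_as' : ld (nx i) (th a s) <= theta + 3 }.

(** The forbidden sets together have fewer than [m] elements. The numbers 9, 8 and 6 are the largest
    that the choices of [b] and [c] need. *)
Lemma exists_good_vertex k (s1 s2 : seq {set A}) (s3 : seq A) :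
  all (fun X : {set A} => #|X| <= B0) s1 -> all (fun X : {set A} => #|X| <= w) s2 ->
  size s1 <= 9 -> size s2 <= 8 -> size s3 <= 6 ->
  exists x, [/\ tau x = k, all (fun X : {set A} => x \notin X) s1,
    all (fun X : {set A} => x \notin X) s2 & all (fun y => x != y) s3].
Proof.
move=> h1 h2 z1 z2 z3.
have un (b : nat) (s : seq {set A}) : all (fun X : {set A} => #|X| <= b) s ->
    #|\bigcup_(X <- s) X| <= size s * b.
  elim: s => [|X s IH] /=; first by rewrite big_nil cards0.
  case/andP=> hX /IH hs; rewrite big_cons mulSn.
  by apply: leq_trans (leq_add hX hs); rewrite cardsU leq_subr.
have un3 (s : seq A) : #|[set x in s]| <= size s.
  by rewrite cardsE card_size.
pose bad := (\bigcup_(X <- s1) X) :|: (\bigcup_(X <- s2) X) :|: [set x in s3].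
have bad_lt : #|bad| < m.
  apply: leq_trans m_gt; rewrite ltnS /bad cardsU.
  apply: leq_trans (leq_subr _ _) _; rewrite cardsU.
  have := un _ _ h1; have := un _ _ h2; have := un3 s3.
  have := leq_mul z1 (leqnn B0); have := leq_mul z2 (leqnn w).
  lia.
have [x] : exists x, x \in [set x | tau x == k] :\: bad.
  apply/set0Pn; rewrite -card_gt0 cardsD tau_card subn_gt0.
  by apply: leq_ltn_trans bad_lt; rewrite subset_leq_card // subsetIr.
rewrite !inE !negb_or => /andP[/andP[/andP[n1 n2] n3] /eqP tx].
exists x; split=> //.
- by apply/allP => X hX; apply: contra n1 => hx; rewrite bigcup_seq; apply/bigcupP; exists X.
- by apply/allP => X hX; apply: contra n2 => hx; rewrite bigcup_seq; apply/bigcupP; exists X.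
- by apply/allP => y hy; apply: contra n3 => /eqP->.
Qed.

(** The map [f] turns a condition on a vertex such as [th a x] into a set of forbidden values of
    [x]. *)
Definition half_line U k j u (f : A -> A) := [set x | (tau x == k) && ((j, u, f x) \in U)].
Definition overloaded (ld : 'I_3 -> A -> nat) j (f : A -> A) := [set x | theta <= ld j (f x)].

Lemma half_lineN U k j u f x : tau x = k -> x \notin half_line U k j u f ->
  (j, u, f x) \notin U.
Proof. by move=> h; rewrite inE h eqxx. Qed.

Lemma overloadedN ld j f x : x \notin overloaded ld j f -> ld j (f x) < theta.
Proof. by rewrite inE -ltnNge. Qed.

Section Pick.
Variables (U : {set edge A}) (ld : 'I_3 -> A -> nat) (D : seq (tri A)).
Variables (mu pos Q : edge A -> nat).
Hypothesis st : state U ld D mu pos Q.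

(** [f] is injective and shifts colours by a constant, so the image lies in a single colour class,
    where the load bounds it. *)
Lemma card_half_line k j u f : injective f -> (exists k', forall x, tau (f x) = k' (+) tau x) ->
  #|half_line U k j u f| <= B0.
Proof.
move=> fI [k' ft]; rewrite -(card_imset _ fI).
apply: leq_trans (leq_trans (st_half st j u (k' (+) k)) _).
  apply/subset_leq_card/subsetP => _ /imsetP[x + ->]; rewrite !inE ft.
  by case/andP => /eqP-> ->; rewrite eqxx.
by apply: leq_trans (st_ld st j u); rewrite leq_addr.
Qed.

(** By Markov's inequality: [w.+1] vertices of load at least [theta] would exceed the total [M]. *)
Lemma card_overloaded j f : injective f -> #|overloaded ld j f| <= w.
Proof.
move=> fI; rewrite -(card_imset _ fI) leqNgt; apply/negP => h.
move: M_lt; rewrite ltnNge => /negP; apply.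
apply: leq_trans (st_sum st j); apply: leq_trans (leq_addr _ _).
apply: leq_trans (_ : theta * #|f @: overloaded ld j f| <= _); first by rewrite leq_mul2l h orbT.
rewrite mulnC -sum_nat_const.
rewrite [X in _ <= X](bigID [in f @: overloaded ld j f]) /=.
apply: leq_trans (leq_addr _ _); apply: leq_sum => _ /imsetP[x + ->].
by rewrite inE.
Qed.

End Pick.

(* Vertices b and c extending the path to r, s, t, p, q with apex c; the triangles
   to be subtracted are (b, t, a), (s, c, a) and (b, c, p), the last of which may
   also be a Latin square triangle. *)
Record good_choice i s t a p q r U (ld : 'I_3 -> A -> nat) b c : Prop := GoodChoice {
  ch_odd1 : tau b (+) tau t (+) tau a;
  ch_odd2 : tau s (+) tau c (+) tau a;
  ch_odd3 : ~~ (tau b (+) tau c (+) tau p) -> th b c = p;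
  ch_bt : (i, b, t) \notin U;
  ch_dis1 : [disjoint clique (octa th i b t a) & U];
  ch_dis2 : [disjoint clique (octa th i s c a) & U];
  ch_dis3 : [disjoint clique (if tau b (+) tau c (+) tau p then octa th i b c p
                              else tria i b c p) & U];
  ch_sc : (i, s, c) \notin U;
  ch_qc : (i, q, c) \notin U;
  ch_cr : (nx i, c, r) \notin U;
  ch_b : (b != s) && (b != q);
  ch_c1 : c != t;
  ch_c2 : c != th a b;
  ch_c3 : c != th p s;
  ch_c4 : c != th a q;
  ch_c5 : p != r -> c != th r b;
  ch_c6 : c != th r q;
  ch_ld0 : [/\ ld i b < theta, ld i (th c a) < theta & ld i (th c r) < theta];
  ch_ld1 : ld (nx i) c < theta /\ ld (nx i) (th a b) < theta;
  ch_ld2 : [/\ ld (nx (nx i)) (th b t) < theta, ld (nx (nx i)) (th s c) < theta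
    & ld (nx (nx i)) (th q c) < theta];
  ch_ld3 : tau b (+) tau c (+) tau p ->
    [/\ ld i (th c p) < theta, ld (nx i) (th p b) < theta
      & ld (nx (nx i)) (th b c) < theta] }.

(* If t, s and p have an odd number of reflections then so have b, c and p, and b
   and c are chosen one after the other; otherwise b determines c = th p b. *)
Lemma good_choice_exists i s t a p q r U ld D mu :
  open_state i s t a U ld D mu -> 0 < mu (nx i, t, p) ->
  exists b c, good_choice i s t a p q r U ld b c.
Proof.
move=> sB mtp; have st := os_st sB; have cU := st_rot st.
have ta := os_ta sB; have as_ := os_as sB.
have tp : (nx i, t, p) \in U by apply: st_sub st _ mtp.
have pa : p != a by apply: contraNneq ta => <-.
have R1 j u v : ((nx j, v, th u v) \in U) = ((j, u, v) \in U) by exact: rotE.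
have R2 j u v : ((nx (nx j), th u v, u) \in U) = ((j, u, v) \in U).
  by rewrite -(rotVE dih).
have injs y : (injective (th y) * injective (th^~ y))%type.
  by split; [exact: th_injr | exact: th_injl].
have tauc : (exists k', forall x, tau x = k' (+) tau x).
  by exists false.
have taur y : exists k', forall x, tau (th y x) = k' (+) tau x.
  by exists (tau y) => x; rewrite thT.
have taul y : exists k', forall x, tau (th x y) = k' (+) tau x.
  by exists (tau y) => x; rewrite thT addbC.
have idI : injective (@id A) by [].
(* Oddness of (b, t, a) and (s, c, a) forces the colours of [b] and [c]; then (b, c, p) has the
   parity of (t, s, p). *)
have [odd|ev] := boolP (tau t (+) tau s (+) tau p).
  have [|||||b] := @exists_good_vertex (~~ (tau t (+) tau a))
     [:: half_line U (~~ (tau t (+) tau a)) (nx i) t (th^~ t);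
         half_line U (~~ (tau t (+) tau a)) (nx (nx i)) a id;
         half_line U (~~ (tau t (+) tau a)) i (th t a) (th a);
         half_line U (~~ (tau t (+) tau a)) (nx (nx i)) p id]
     [:: overloaded ld i id; overloaded ld (nx i) (th a); overloaded ld (nx (nx i)) (th^~ t);
         overloaded ld (nx i) (th p)] [:: s; q] => //.
  - by rewrite /= !(card_half_line st) //; do ?[exact: (injs _).1 | exact: (injs _).2].
  - by rewrite /= !(card_overloaded st) //; do ?[exact: (injs _).1 | exact: (injs _).2].
  case=> tb /= /and5P[/(half_lineN tb) b1 /(half_lineN tb) b2
     /(half_lineN tb) b3 /(half_lineN tb) b4 _].
  move=> /and5P[/overloadedN o1 /overloadedN o2 /overloadedN o3 /overloadedN o4 _].
  case/and3P => bs bq _.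
  have [|||||c] := @exists_good_vertex (~~ (tau s (+) tau a))
     [:: half_line U (~~ (tau s (+) tau a)) i s id;
         half_line U (~~ (tau s (+) tau a)) (nx (nx i)) a (th^~ a);
         half_line U (~~ (tau s (+) tau a)) (nx i) (th a s) (th s);
         half_line U (~~ (tau s (+) tau a)) i b id;
         half_line U (~~ (tau s (+) tau a)) (nx (nx i)) p (th^~ p);
         half_line U (~~ (tau s (+) tau a)) (nx i) (th p b) (th b);
         half_line U (~~ (tau s (+) tau a)) i q id;
         half_line U (~~ (tau s (+) tau a)) (nx (nx i)) r (th^~ r)]
     [:: overloaded ld (nx i) id; overloaded ld i (th^~ a); overloaded ld (nx (nx i)) (th s);
         overloaded ld i (th^~ p); overloaded ld (nx (nx i)) (th b);
         overloaded ld (nx (nx i)) (th q); overloaded ld i (th^~ r)]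
     [:: t; th a b; th p s; th a q; th r b; th r q] => //.
  - by rewrite /= !(card_half_line st) //; do ?[exact: (injs _).1 | exact: (injs _).2].
  - by rewrite /= !(card_overloaded st) //; do ?[exact: (injs _).1 | exact: (injs _).2].
  case=> tc /= /and5P[/(half_lineN tc) c1 /(half_lineN tc) c2
     /(half_lineN tc) c3 /(half_lineN tc) c4].
  move=> /and5P[/(half_lineN tc) c5 /(half_lineN tc) c6
     /(half_lineN tc) c7 /(half_lineN tc) c8 _].
  move=> /and5P[/overloadedN oc1 /overloadedN oc2 /overloadedN oc3 /overloadedN oc4].
  move=> /and4P[/overloadedN oc5 /overloadedN oc6 /overloadedN oc7 _].
  case/and5P=> n1 n2 n3 n4 /and3P[n5 n6 _].
  have odd1 : tau b (+) tau t (+) tau a.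
    by rewrite tb; case: (tau t) (tau a) => [] [].
  have odd2 : tau s (+) tau c (+) tau a.
    by rewrite tc; case: (tau s) (tau a) => [] [].
  have odd3 : tau b (+) tau c (+) tau p.
    by move: odd; rewrite tb tc; case: (tau s) (tau t) (tau p) (tau a) => [] [] [] [].
  exists b, c; split=> //; rewrite ?odd3 ?bs //.
  - by rewrite -R1.
  - apply: octa_free => //; by rewrite -R1.
  - apply: octa_free => //; first by rewrite -R1.
    by rewrite -R1 thO.
  - apply: octa_free => //; first by rewrite -R1.
    by rewrite -R1 thO.
  - by rewrite -R1.
(* Now (b, c, p) has to be a Latin square triangle, so c = th p b and all conditions on [c] become
   conditions on [b]. *)
have [|||||b] := @exists_good_vertex (~~ (tau t (+) tau a))
   [:: half_line U (~~ (tau t (+) tau a)) (nx i) t (th^~ t);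
       half_line U (~~ (tau t (+) tau a)) (nx (nx i)) a id;
       half_line U (~~ (tau t (+) tau a)) i (th t a) (th a);
       half_line U (~~ (tau t (+) tau a)) (nx (nx i)) p id;
       half_line U (~~ (tau t (+) tau a)) i s (th p);
       half_line U (~~ (tau t (+) tau a)) (nx (nx i)) a (fun x => th (th p x) a);
       half_line U (~~ (tau t (+) tau a)) (nx i) (th a s) (fun x => th s (th p x));
       half_line U (~~ (tau t (+) tau a)) i q (th p);
       half_line U (~~ (tau t (+) tau a)) (nx (nx i)) r (fun x => th (th p x) r)]
   [:: overloaded ld i id; overloaded ld (nx i) (th a); overloaded ld (nx (nx i)) (th^~ t);
       overloaded ld (nx i) (th p); overloaded ld i (fun x => th (th p x) a);
       overloaded ld (nx (nx i)) (fun x => th s (th p x));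
       overloaded ld (nx (nx i)) (fun x => th q (th p x));
       overloaded ld i (fun x => th (th p x) r)]
   [:: s; q; th (th a q) p; th (th r q) p] => //.
- have tau2 y : exists k', forall x, tau (th (th p x) y) = k' (+) tau x.
    exists (tau p (+) tau y) => x; rewrite !thT.
    by case: (tau p) (tau x) (tau y) => [] [] [].
  have tau2' y : exists k', forall x, tau (th y (th p x)) = k' (+) tau x.
    exists (tau p (+) tau y) => x; rewrite !thT.
    by case: (tau p) (tau x) (tau y) => [] [] [].
  have inj2 y : (injective (fun x => th (th p x) y) * injective (fun x => th y (th p x)))%type.
    by split=> x x'; [move/(@th_injl y) | move/th_injr] => /th_injr.
  by rewrite /= !(card_half_line st) //; do ?[exact: (inj2 _).1 | exact: (inj2 _).2].
- have inj2 y : (injective (fun x => th (th p x) y) * injective (fun x => th y (th p x)))%type.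
    by split=> x x'; [move/(@th_injl y) | move/th_injr] => /th_injr.
  by rewrite /= !(card_overloaded st) //; do ?[exact: (inj2 _).1 | exact: (inj2 _).2].
case=> tb /= /and5P[/(half_lineN tb) b1 /(half_lineN tb) b2
   /(half_lineN tb) b3 /(half_lineN tb) b4].
move=> /and5P[/(half_lineN tb) /= b5 /(half_lineN tb) /= b6 /(half_lineN tb) /= b7
   /(half_lineN tb) /= b8] /andP[/(half_lineN tb) /= b9 _].
move=> /and5P[/overloadedN o1 /overloadedN o2 /overloadedN o3 /overloadedN o4].
move=> /and5P[/overloadedN /= o5 /overloadedN /= o6 /overloadedN /= o7 /overloadedN /= o8 _].
case/and5P => bs bq n1 n2 _.
have odd1 : tau b (+) tau t (+) tau a.
  by rewrite tb; case: (tau t) (tau a) => [] [].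
have odd2 : tau s (+) tau (th p b) (+) tau a.
  by move: ev; rewrite thT tb; case: (tau s) (tau t) (tau p) (tau a) => [] [] [] [].
have even3 : tau b (+) tau (th p b) (+) tau p = false.
  by rewrite thT; case: (tau b) (tau p) => [] [].
have bt : (i, b, t) \notin U by rewrite -R1.
exists b, (th p b); split=> //; rewrite ?even3 ?bs //.
- apply: octa_free => //; by rewrite -R1.
- apply: octa_free => //; first by rewrite -R1.
  by rewrite -R1 thO.
- by apply: (tria_free dih) => //; rewrite -R2 thC.
- by rewrite -R1.
(* If c = t then th b t = p, and the edge (t, p) of [U] would bring (b, t) into [U]. *)
- by apply: contraNneq bt => bt; rewrite -bt -R1 thC bt.
- by apply: contra_neq pa => /th_injl.
- by apply: contra_neq bs => /th_injr.
- by apply: contra_neq n1 => <-; rewrite thCC.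
- by apply: contra_neq => /th_injl.
- by apply: contra_neq n2 => <-; rewrite thCC.
Qed.


(** * One step of the walk *)

Definition half_bounded U (ld : 'I_3 -> A -> nat) :=
  forall j u k, #|[set v | (tau v == k) && ((j, u, v) \in U)]| <= ld j u.

(** The Latin square triangles in [P] are replaced by [X], that is, by themselves minus [T]. By
    [block_tau] a line gains at most one vertex of each colour, so raising the load by 1 on [P]
    suffices, and [P] has at most two vertices in a part. *)
Lemma add_block P T U ld D :
  block tau th P T -> [disjoint clique P & U] -> rot_closed th U -> half_bounded U ld ->
  [/\ rot_closed th (U :|: clique P),
      half_bounded (U :|: clique P) (fun j v => ld j v + P j v),
      forall j, \sum_v (ld j v + P j v) <= \sum_v ld j v + 2
    & exists D', forall e,
        (e \notin U :|: clique P) + cov D' e + bdry T e = (e \notin U) + cov D e].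
Proof.
case=> rP tP [X covX] dis cU hU; split.
- by move=> e; rewrite !in_setU => /orP[/cU->//|/rP->]; rewrite orbT.
- move=> j u k.
  apply: leq_trans (_ : #|[set v | (tau v == k) && ((j, u, v) \in U)] :|:
     [set v | [&& tau v == k, P j u & P (nx j) v]]| <= _).
    apply/subset_leq_card/subsetP => v; rewrite !inE /=.
    by case: (tau v == k).
  rewrite cardsU; apply: leq_trans (leq_subr _ _) _; rewrite leq_add ?hU //.
  case: (P j u); last by rewrite eq_card0 // => v; rewrite !inE andbF.
  apply/card_le1_eqP => x y; rewrite !inE => /andP[/eqP tx Px] /andP[/eqP ty Py].
  by apply: (tP (nx j)) => //; rewrite tx ty.
- move=> j; rewrite big_split leq_add2l /=.
  have -> : \sum_v P j v = #|[set v | P j v]|.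
    by rewrite -sum1dep_card [RHS]big_mkcond; apply: eq_bigr => v _; case: (P j v).
  have inj : {in [set v | P j v] &, injective tau}.
    by move=> x y; rewrite !inE => Px Py; apply: (tP j).
  have := max_card [in [set tau v | v in [set v | P j v]]].
  by rewrite card_in_imset // card_bool.
exists (D ++ X) => e; rewrite cov_cat.
have := covX e; have := disjointFr dis (x := e).
by rewrite in_setU; case: (e \in clique P) => [/(_ isT)->|_]; rewrite ?orbT ?orbF /=; lia.
Qed.

Lemma disjoint_setUr (X Y Z : {set edge A}) :
  [disjoint X & Y] -> [disjoint X & Z] -> [disjoint X & Y :|: Z].
Proof.
by rewrite -!setI_eq0 => /eqP hY /eqP hZ; rewrite setIUr hY hZ setU0.
Qed.

Definition third_block i b c p := if tau b (+) tau c (+) tau p then octa th i b c p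
  else tria i b c p.

Section Step.
Variables (i : 'I_3) (s t a p q r b c : A).
Variables (U : {set edge A}) (ld : 'I_3 -> A -> nat) (D : seq (tri A)) (mu : edge A -> nat).
Hypothesis sB : open_state i s t a U ld D mu.
Hypothesis mtp : 0 < mu (nx i, t, p).
Hypothesis ch : good_choice i s t a p q r U ld b c.

Let st := os_st sB.
Let cU := st_rot st.
Let P1 := octa th i b t a.
Let P2 := octa th i s c a.
Let P3 := third_block i b c p.

Let odd1 := ch_odd1 ch.
Let odd2 := ch_odd2 ch.

Let bl1 : block tau th P1 (i, b, t, a) := octa_block dih i odd1.
Let bl2 : block tau th P2 (i, s, c, a) := octa_block dih i odd2.

Let bl3 : block tau th P3 (i, b, c, p).
Proof.
rewrite /P3 /third_block; have := ch_odd3 ch.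
by case: ifP => [odd _|_ /(_ isT) h]; [exact: octa_block | exact: tria_block].
Qed.

Let rotU j u v : ((nx j, v, th u v) \in U) = ((j, u, v) \in U).
Proof. exact: rotE. Qed.

Let tpU : (nx i, t, p) \in U. Proof. by apply: st_sub st _ mtp. Qed.

Let pa : p != a.
Proof. by apply: contraNneq (os_ta sB) => <-. Qed.

Let bs : b == s = false. Proof. by apply/negbTE; case/andP: (ch_b ch). Qed.

Let btp : p == th b t = false.
Proof. by apply/negbTE; apply: contraNneq (ch_bt ch) => h; rewrite -rotU -h. Qed.

Let cP1 : P1 (nx i) c = false.
Proof. by rewrite /P1 octaE /= (negbTE (ch_c1 ch)) (negbTE (ch_c2 ch)). Qed.

Let s2b : th c a == b = false.
Proof. by apply: contra_neqF (ch_c2 ch) => /eqP <-; rewrite thC. Qed.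

Let bP2 : P2 i b = false.
Proof. by rewrite /P2 octaE /= bs eq_sym s2b. Qed.

(** The three blocks must also be edge-disjoint from each other. That [c] is outside [P1] and [b]
    outside [P2] excludes most coincidences. *)
Let dis21 : [disjoint clique P2 & clique P1].
Proof.
apply: octa_free => //; first exact: block_rot bl1.
- by rewrite in_clique cP1 andbF.
- by rewrite in_clique cP1.
- rewrite in_clique nx3 /P1 !octaE /= [s == b]eq_sym bs.
  by rewrite (negbTE (os_neq sB)) andbF.
rewrite in_clique /P1 octaE /= s2b /=.
have [/th_injl e|//] := eqVneq (th c a) (th t a).
by move: (ch_c1 ch); rewrite e eqxx.
Qed.

Let dis31 : [disjoint clique P3 & clique P1].
Proof.
rewrite /P3 /third_block; case: ifP => [odd|even].
  apply: octa_free => //; first exact: block_rot bl1.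
  - by rewrite in_clique cP1 andbF.
  - by rewrite in_clique cP1.
  - by rewrite in_clique /P1 octaE /= (negbTE pa) btp.
  rewrite in_clique /P1 [octa _ _ _ _ _ (nx i) _]octaE /=.
  have [e|_] := eqVneq (th p b) t; first by have := btp; rewrite -e thC eqxx.
  have [/th_injl e|_] := eqVneq (th p b) (th a b); first by have := pa; rewrite e eqxx.
  by rewrite andbF.
apply: (tria_free dih) => //; first exact: block_rot bl1.
  by apply: (ch_odd3 ch); rewrite even.
by rewrite in_clique cP1 andbF.
Qed.

Let dis32 : [disjoint clique P3 & clique P2].
Proof.
rewrite /P3 /third_block; case: ifP => [odd|even].
  apply: octa_free => //; first exact: block_rot bl2.
  - by rewrite in_clique bP2.
  - rewrite in_clique /P2 [octa _ _ _ _ _ (nx (nx i)) _]octaE /= (negbTE pa) /=.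
    have [e|_] := eqVneq p (th s c); last by rewrite andbF.
    by move: (ch_c3 ch); rewrite e thCC eqxx.
  - by rewrite in_clique nx3 bP2 andbF.
  rewrite in_clique /P2 [octa _ _ _ _ _ i _]octaE /=.
  have [e|_] := eqVneq (th c p) s; first by move: (ch_c3 ch); rewrite -e thC eqxx.
  by have [/th_injr e|//] := eqVneq (th c p) (th c a); have := pa; rewrite e eqxx.
apply: (tria_free dih) => //; first exact: block_rot bl2.
  by apply: (ch_odd3 ch); rewrite even.
by rewrite in_clique bP2.
Qed.

Let U' := U :|: clique P1 :|: clique P2 :|: clique P3.
Let ld' j v := ld j v + P1 j v + P2 j v + P3 j v.

Lemma step_blocks : [/\ rot_closed th U', half_bounded U' ld',
      forall j, \sum_v ld' j v <= \sum_v ld j v + 6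
    & exists D', forall e, (e \notin U') + cov D' e + bdry (i, b, t, a) e
        + bdry (i, s, c, a) e + bdry (i, b, c, p) e = (e \notin U) + cov D e].
Proof.
have [c1 h1 s1 [D1 e1]] := add_block D bl1 (ch_dis1 ch) cU (st_half st).
have d2 : [disjoint clique P2 & U :|: clique P1].
  by apply: disjoint_setUr dis21; exact: ch_dis2 ch.
have [c2 h2 s2 [D2 e2]] := add_block D1 bl2 d2 c1 h1.
have d3 : [disjoint clique P3 & U :|: clique P1 :|: clique P2].
  by do 2?apply: disjoint_setUr => //; exact: ch_dis3 ch.
have [c3 h3 s3 [D3 e3]] := add_block D2 bl3 d3 c2 h2.
split=> // [j|].
  apply: leq_trans (s3 j) _; rewrite -[6]/(4 + 2) addnA leq_add2r.
  apply: leq_trans (s2 j) _; rewrite -[4]/(2 + 2) addnA leq_add2r.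
  exact: s1.
exists D3 => e; rewrite -e1 -e2 -e3 addnAC.
by rewrite [_ + bdry (i, b, c, p) e]addnAC addnAC.
Qed.

(** In one step each of s, t, p loses one outgoing edge of [Q]. *)
Let pass j v : nat := ((j, v) == (i, s)) + ((j, v) == (nx i, t)) + ((j, v) == (nx (nx i), p)).

(** All vertices of the blocks except s, t, p have load at most theta + 3: those depending on [b] or
    [c] by the choice of [b] and [c], the others by the bounds that come with the apex [a]. Each of
    s, t, p can only be counted once. *)
Lemma step_inc j v : (P1 j v + P2 j v + P3 j v <= 3) /\
  (theta + 3 < ld j v -> P1 j v + P2 j v + P3 j v <= pass j v).
Proof.
split; first by case: (P1 j v) (P2 j v) (P3 j v) => [] [] [].
move=> big.
have ne x : ld j x <= theta + 3 -> (v == x) = false.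
  by move=> h; apply/eqP => e; move: big; rewrite e ltnNge h.
have ne' x : ld j x < theta -> (v == x) = false.
  by move=> h; apply: ne; apply: leq_trans (ltnW h) (leq_addr _ _).
have [b0 b1 b2] := ch_ld0 ch; have [b3 b4] := ch_ld1 ch; have [b5 b6 b7] := ch_ld2 ch.
have ld3 := ch_ld3 ch; rewrite /P1 /P2 /P3 /third_block /pass !xpair_eqE.
have [[a1 a2] a3] := (os_a sB, os_ta' sB, os_as' sB).
case: (nxP i j) ne ne' => ne ne'; rewrite !octaE !nx_neq eqxx /=.
- rewrite (ne' _ b0) (ne _ a2) (ne' _ b1) /= orbF.
  case: ifP ld3 => [_ /(_ isT) [l1 l2 l3]|even _].
    by rewrite octaE /= (ne' _ b0) (ne' _ l1) !addn0.
  by rewrite triaE /= (ne' _ b0) !addn0.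
- rewrite (ne' _ b3) (ne' _ b4) (ne _ a3) /= orbF !addn0.
  case: ifP ld3 => [_ /(_ isT) [l1 l2 l3]|even _].
    by rewrite octaE /= (ne' _ b3) (ne' _ l2) !addn0.
  by rewrite triaE /= (ne' _ b3) !addn0.
rewrite (ne _ a1) (ne' _ b5) (ne' _ b6) /=.
case: ifP ld3 => [_ /(_ isT) [l1 l2 l3]|even _].
  by rewrite octaE /= (ne' _ l3) orbF.
by rewrite triaE.
Qed.

End Step.

Lemma bdryE i u v x (e : edge A) : bdry (i, u, v, x) e =
  unit_edge (i, u, v) e + unit_edge (nx i, v, x) e + unit_edge (nx (nx i), x, u) e.
Proof. by []. Qed.

Lemma nx_pair_eq i j x y : ((nx i, x) == (nx j, y)) = ((i, x) == (j, y)).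
Proof. by rewrite !xpair_eqE (inj_eq nx_inj). Qed.

(** A load of at most theta + 3 becomes at most theta + 6, and [d0] bounds the degree, which
    explains [B0]. A larger load grows by no more than the degree in [Q] falls. *)
Lemma step_ld i s t a p q r b c U ld D mu Q' j v :
  open_state i s t a U ld D mu -> good_choice i s t a p q r U ld b c ->
  outd (fun e => mu e + unit_edge (i, s, t) e) j v = outd Q' j v
    + (((j, v) == (i, s)) + ((j, v) == (nx i, t)) + ((j, v) == (nx (nx i), p))) ->
  ld j v + octa th i b t a j v + octa th i s c a j v + third_block i b c p j v
    + outd Q' j v <= B0.
Proof.
move=> sB ch oQ; have [inc3 incp] := step_inc sB ch j v.
have := st_ld (os_st sB) j v; have := st_out (os_st sB) j v.
rewrite oQ /B0; move: inc3 incp.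
set x1 := nat_of_bool (octa th i b t a j v).
set x2 := nat_of_bool (octa th i s c a j v).
set x3 := nat_of_bool (third_block i b c p j v).
set y := _ + _ + _ : nat in oQ *.
move: (ld j v) (outd Q' j v) x1 x2 x3 y {oQ} => l o x1 x2 x3 y.
have [sm|big] := leqP l (theta + 3); first by lia.
by move=> h1 /(_ isT); lia.
Qed.

(** In (s,c,r) + (b,t,p) + (q,c,p) + (b,c,a) - (b,t,a) - (s,c,a) - (b,c,p) there remain the edges
    rs, tp, pq of [mu], the new double edges qc, cr, and the old ones ta, as with sign -1. *)
Lemma step_open i s t a p q r b c U ld D mu mu' :
  open_state i s t a U ld D mu -> good_choice i s t a p q r U ld b c ->
  (forall e, mu e = mu' e + (unit_edge (nx (nx i), r, s) e
     + unit_edge (nx i, t, p) e + unit_edge (nx (nx i), p, q) e)) ->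
  p != r -> q != s ->
  exists U' ld' D', open_state (nx (nx i)) r q c U' ld' D' mu'.
Proof.
move=> sB ch muE pr qs; have st := os_st sB.
have unit_self (e : edge A) : unit_edge e e = 1 by rewrite /unit_edge eqxx.
have mtp : 0 < mu (nx i, t, p) by rewrite muE unit_self; lia.
have mrs : 0 < mu (nx (nx i), r, s) by rewrite muE unit_self; lia.
have mpq : 0 < mu (nx (nx i), p, q) by rewrite muE unit_self; lia.
have [c3 h3 s3 [D1 e3]] := step_blocks sB mtp ch.
have cU := st_rot st.
have rU := st_sub st mrs; have qU := st_sub st mpq.
set U' := (X in rot_closed _ X) in c3 *; rewrite -/U' in h3 e3.
exists U', (fun j v => ld j v + octa th i b t a j v + octa th i s c a j v
  + third_block i b c p j v), [:: (i, s, c, r), (i, b, t, p), (i, q, c, p), (i, b, c, a) & D1].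
have QE e : mu e + unit_edge (i, s, t) e = mu' e + (unit_edge (nx (nx i), r, s) e
     + unit_edge (nx i, t, p) e + unit_edge (nx (nx i), p, q) e + unit_edge (i, s, t) e).
  by rewrite muE !addnA.
have oQ j v : outd (fun e => mu e + unit_edge (i, s, t) e) j v =
    outd (fun e => mu' e + unit_edge (nx (nx i), r, q) e) j v
    + (((j, v) == (i, s)) + ((j, v) == (nx i, t)) + ((j, v) == (nx (nx i), p))).
  rewrite (outdD QE) !(outdD (fun=> erefl)) !outd_unit; lia.
have cP1 : octa th i b t a (nx i) c = false.
  by rewrite octaE /= (negbTE (ch_c1 ch)) (negbTE (ch_c2 ch)).
have le3 j v : ld j v < theta -> ld j v + octa th i b t a j v + octa th i s c a j v
  + third_block i b c p j v <= theta + 3.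
  by have [+ _] := step_inc sB ch j v; rewrite -!addnA => h l; rewrite leq_add // ltnW.
split.
- split=> //.
  + by move=> e h; rewrite !in_setU (st_sub st) // muE; apply: ltn_addr.
  + move=> e; have := e3 e; have := st_cov st e.
    rewrite muE !cov_cons !bdryE !nx3 /=.
    move: (e \notin U) (e \notin U') (e \in H) (cov D e) (cov D1 e) (mu' e) => k1 k2 k3 k4 k5 k6.
    move: (nat_of_bool k1) (nat_of_bool k2) (nat_of_bool k3) => {k1 k2 k3} k1 k2 k3.
    lia.
  + move=> j v; have := st_bal st j v.
    rewrite (indD QE) oQ !(indD (fun=> erefl)) !ind_unit.
    have -> : ((nx j, v) == (i, s)) = ((j, v) == (nx (nx i), s)).
      by rewrite -[in LHS](nx3 i) nx_pair_eq.
    rewrite !(nx_pair_eq j); lia.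
  + by move=> j v; apply: leq_trans (st_out st j v); rewrite oQ leq_addr.
  + by move=> j v; apply: step_ld sB ch _; exact: oQ.
  (* The load of a part grows by at most 6 while [Q] loses three edges net, hence the factor 2 in
     [st_sum]. *)
  + move=> j; apply: leq_trans (st_sum st j).
    apply: leq_trans (leq_add (s3 j) (leqnn _)) _.
    rewrite (weightD QE) !(weightD (fun=> erefl)) !weight_unit; lia.
- rewrite nx3 /U' !in_setU !negb_or (ch_qc ch) !in_clique cP1 andbF /=.
  have /andP[_ bq] := ch_b ch.
  have -> : octa th i s c a i q = false.
    rewrite octaE /= (negbTE qs); apply/eqP => e.
    by move: (ch_c4 ch); rewrite e thC eqxx.
  apply/negP => /andP[+ _]; rewrite /third_block.
  case: ifP => _; rewrite ?octaE ?triaE /= [q == b]eq_sym (negbTE bq) //= => /eqP e.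
  move: (ch_qc ch); rewrite e -(rotE dih _ _ _ cU) => /negP[].
  by move: qU; rewrite -(rotE dih _ _ _ cU) nx3 e thC -(rotE dih _ _ _ cU).
- rewrite nx3 /U' !in_setU !negb_or (ch_cr ch) !in_clique cP1 /=.
  have -> : octa th i s c a (nx (nx i)) r = false.
    rewrite octaE /=; apply/negP => /orP[]/eqP e; first by move: (os_as sB); rewrite -e rU.
    by move: rU (ch_sc ch); rewrite e -(rotVE dih _ _ _ cU) => ->.
  rewrite andbF /=; apply/negP => /andP[_]; rewrite /third_block.
  case: ifP => _; rewrite ?octaE ?triaE /= [r == p]eq_sym (negbTE pr) //= => /eqP e.
  by move: (ch_c5 ch pr); rewrite e thCC eqxx.
- by apply: contra_neq (ch_c6 ch) => ->; rewrite thCC.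
- by rewrite nx3; apply: le3; case: (ch_ld1 ch).
- by apply: le3; case: (ch_ld2 ch).
- by rewrite nx3; apply: le3; case: (ch_ld0 ch).
Qed.

(* The case q = s, r = p, where the path closes up. *)
Lemma step_close i s t a p b c U ld D mu mu' :
  open_state i s t a U ld D mu -> good_choice i s t a p s p U ld b c ->
  (forall e, mu e = mu' e + (unit_edge (nx i, t, p) e + unit_edge (nx (nx i), p, s) e)) ->
  exists U' ld' D', closed_state U' ld' D' mu'.
Proof.
move=> sB ch muE; have st := os_st sB.
have unit_self (e : edge A) : unit_edge e e = 1 by rewrite /unit_edge eqxx.
have mtp : 0 < mu (nx i, t, p) by rewrite muE unit_self; lia.
have [c3 h3 s3 [D1 e3]] := step_blocks sB mtp ch.
set U' := (X in rot_closed _ X) in c3 *; rewrite -/U' in h3 e3.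
exists U', (fun j v => ld j v + octa th i b t a j v + octa th i s c a j v
  + third_block i b c p j v), [:: (i, b, t, p), (i, s, c, p), (i, b, c, a) & D1].
have QE e : mu e + unit_edge (i, s, t) e = mu' e
    + (unit_edge (nx i, t, p) e + unit_edge (nx (nx i), p, s) e + unit_edge (i, s, t) e).
  by rewrite muE !addnA.
have oQ j v : outd (fun e => mu e + unit_edge (i, s, t) e) j v = outd mu' j v
    + (((j, v) == (i, s)) + ((j, v) == (nx i, t)) + ((j, v) == (nx (nx i), p))).
  by rewrite (outdD QE) !(outdD (fun=> erefl)) !outd_unit; lia.
split=> //.
- by move=> e h; rewrite !in_setU (st_sub st) // muE; apply: ltn_addr.
- move=> e; have := e3 e; have := st_cov st e.
  rewrite muE !cov_cons !bdryE /=.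
  move: (e \notin U) (e \notin U') (e \in H) (cov D e) (cov D1 e) (mu' e) => k1 k2 k3 k4 k5 k6.
  move: (nat_of_bool k1) (nat_of_bool k2) (nat_of_bool k3) => {k1 k2 k3} k1 k2 k3.
  lia.
- move=> j v; have := st_bal st j v.
  rewrite (indD QE) oQ !(indD (fun=> erefl)) !ind_unit.
  have -> : ((nx j, v) == (i, s)) = ((j, v) == (nx (nx i), s)).
    by rewrite -[in LHS](nx3 i) nx_pair_eq.
  rewrite !(nx_pair_eq j); lia.
- by move=> j v; apply: leq_trans (st_out st j v); rewrite oQ leq_addr.
- by move=> j v; apply: step_ld sB ch _; exact: oQ.
- move=> j; apply: leq_trans (st_sum st j).
  apply: leq_trans (leq_add (s3 j) (leqnn _)) _.
  rewrite (weightD QE) !(weightD (fun=> erefl)) !weight_unit; lia.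
Qed.

(** The triangle (s, t, a) covers (s, t) and doubles (t, a) and (a, s); [Q] stays the same, as (s,
    t) passes from [mu] to the path. *)
Lemma step_start i s t U ld D mu : closed_state U ld D mu -> 0 < mu (i, s, t) ->
  exists a, open_state i s t a U ld ((i, s, t, a) :: D) (decr mu (i, s, t)).
Proof.
move=> st mst; have muE := decrE mst.
have [|||||a] := @exists_good_vertex false
  [:: half_line U false (nx i) t id; half_line U false i s (th^~ s)]
  [:: overloaded ld (nx (nx i)) id; overloaded ld i (th t);
      overloaded ld (nx i) (th^~ s)] [:: th s t] => //.
- have tau1 : exists k', forall x, tau x = k' (+) tau x by exists false.
  have tau2 : exists k', forall x, tau (th x s) = k' (+) tau x.
    by exists (tau s) => x; rewrite thT addbC.
  by rewrite /= !(card_half_line st) //; exact: th_injl.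
- by rewrite /= !(card_overloaded st) //; do ?[exact: th_injl | exact: th_injr].
case=> ta /= /and3P[/(half_lineN ta) a1 /(half_lineN ta) a2 _].
move=> /and4P[/overloadedN o1 /overloadedN o2 /overloadedN o3 _] /andP[n1 _].
have le3 n : n < theta -> n <= theta + 3 by move/ltnW=> h; apply: leq_trans h (leq_addr _ _).
have outE j v : outd (fun e => decr mu (i, s, t) e + unit_edge (i, s, t) e) j v = outd mu j v.
  by apply: eq_bigr => x _; rewrite -muE.
have indE j v : ind (fun e => decr mu (i, s, t) e + unit_edge (i, s, t) e) j v = ind mu j v.
  by apply: eq_bigr => x _; rewrite -muE.
have wtE : weight (fun e => decr mu (i, s, t) e + unit_edge (i, s, t) e) = weight mu.
  by apply: eq_bigr => x _; rewrite -muE.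
exists a; split; rewrite ?le3 //.
- split=> //; try by case: st.
  + by move=> e h; apply: (st_sub st); rewrite muE ltn_addr.
  + move=> e; have := st_cov st e; rewrite cov_cons bdryE muE /=; lia.
  + by move=> j v; rewrite outE indE; apply: (st_bal st).
  + by move=> j v; rewrite outE; apply: (st_out st).
  + by move=> j v; rewrite outE; apply: (st_ld st).
  + by move=> j; rewrite wtE; apply: (st_sum st).
- by rewrite -(rotE dih _ _ _ (st_rot st)) nx3.
- by apply: contra_neq n1 => ->; rewrite thCC.
Qed.

(** Balance of [Q] continues the path by (t, p), (p, q) and (r, s) in [mu]. If (p, s) is in [mu] the
    path closes up; otherwise q != s and p != r, so the three edges are distinct. *)
Lemma step i s t a U ld D mu : open_state i s t a U ld D mu ->
  exists mu', weight mu' < weight mu /\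
   ((exists U' ld' D', closed_state U' ld' D' mu') \/
    (exists j s' t' a' U' ld' D', open_state j s' t' a' U' ld' D' mu')).
Proof.
move=> sB; have st := os_st sB; have bal := st_bal st.
have bal' j v : ind mu j v + ((j, v) == (i, t)) = outd mu (nx j) v + ((nx j, v) == (i, s)).
  by have := bal j v; rewrite (indD (fun=> erefl)) (outdD (fun=> erefl)) ind_unit outd_unit.
have in1 j u v : 0 < mu (j, u, v) -> 0 < ind mu j v.
  by move=> h; rewrite /ind (bigD1 u) //= ltn_addr.
have [p mtp] : exists p, 0 < mu (nx i, t, p).
  apply: outd_gt0; have := bal' i t.
  by rewrite eqxx !xpair_eqE nx_neq addn0 => <-; rewrite addn1.
have sub_neq e f : e != f -> 0 < mu f -> 0 < decr mu e f.
  by rewrite /decr /unit_edge eq_sym => /negbTE-> ; rewrite subn0.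
have [mps|] := ltnP 0 (mu (nx (nx i), p, s)).
  have [b [c ch]] := good_choice_exists s p sB mtp.
  have mps' : 0 < decr mu (nx i, t, p) (nx (nx i), p, s).
    by apply: sub_neq => //; rewrite !xpair_eqE nx_neq.
  have muE e : mu e = decr (decr mu (nx i, t, p)) (nx (nx i), p, s) e
      + (unit_edge (nx i, t, p) e + unit_edge (nx (nx i), p, s) e).
    by rewrite (decrE mtp) (decrE mps' e) addnAC addnA.
  exists (decr (decr mu (nx i, t, p)) (nx (nx i), p, s)); split.
    by rewrite [X in _ < X](weightD muE) (weightD (fun=> erefl)) !weight_unit addn2 ltnS leqnSn.
  by left; exact: step_close sB ch muE.
rewrite leqn0 => /eqP mps.
have [q mpq] : exists q, 0 < mu (nx (nx i), p, q).
  apply: outd_gt0; have := bal' (nx i) p; have := in1 _ _ _ mtp.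
  by rewrite !xpair_eqE !nx_neq /= !addn0 => h <-.
have [r mrs] : exists r, 0 < mu (nx (nx i), r, s).
  apply: ind_gt0; have := bal' (nx (nx i)) s.
  by rewrite nx3 eqxx !xpair_eqE nx_neq addn0 => ->; rewrite addn1.
have qs : q != s by apply: contraTneq mpq => ->; rewrite mps.
have pr : p != r by apply: contraTneq mrs => <-; rewrite mps.
have [b [c ch]] := good_choice_exists q r sB mtp.
set m1 := decr mu (nx (nx i), r, s).
have m1tp : 0 < m1 (nx i, t, p) by apply: sub_neq => //; rewrite !xpair_eqE nx_neq.
set m2 := decr m1 (nx i, t, p).
have m2pq : 0 < m2 (nx (nx i), p, q).
  rewrite /m2 /decr {1}/unit_edge !xpair_eqE nx_neq /= subn0.
  by apply: sub_neq => //; rewrite !xpair_eqE [r == p]eq_sym (negbTE pr) andbF.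
have muE e : mu e = decr m2 (nx (nx i), p, q) e + (unit_edge (nx (nx i), r, s) e
     + unit_edge (nx i, t, p) e + unit_edge (nx (nx i), p, q) e).
  by rewrite (decrE mrs) -/m1 (decrE m1tp e) -/m2 (decrE m2pq e); lia.
exists (decr m2 (nx (nx i), p, q)); split.
  by rewrite [X in _ < X](weightD muE) !(weightD (fun=> erefl)) !weight_unit !addnS ltnS; lia.
right; have [U' [ld' [D' h]]] := step_open sB ch muE pr qs.
by do 7!eexists; exact: h.
Qed.

Lemma absorb_aux k :
  (forall U ld D mu, closed_state U ld D mu -> weight mu < k -> decomposable H) /\
  (forall i s t a U ld D mu, open_state i s t a U ld D mu -> weight mu < k -> decomposable H).
Proof.
elim: k => [|k [IHA IHB]]; first by split.
split=> [U ld D mu st lt|i s t a U ld D mu sB lt]; last first.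
  have [mu' [lt' [[U' [ld' [D' h]]]|[j [s' [t' [a' [U' [ld' [D' h]]]]]]]]]] := step sB.
    by apply: IHA h _; apply: leq_trans lt' _.
  by apply: IHB h _; apply: leq_trans lt' _.
have [/eqP|/weight_gt0[[[i s] t] mst]] := posnP (weight mu); last first.
  have [a sB] := step_start st mst; apply: IHB sB _.
  by move: lt; rewrite (weightD (decrE mst)) weight_unit addn1.
rewrite /weight sum_nat_eq0 => /forallP mu0.
have [DL covL] := cov_latin dih (st_rot st).
exists (DL ++ D) => e; rewrite cov_cat covL.
have := st_cov st e; have /implyP/(_ isT)/eqP-> := mu0 e.
by case: (e \in H) => /=; lia.
Qed.

Lemma absorb U ld D mu : closed_state U ld D mu -> decomposable H.
Proof. by move=> st; have [h _] := absorb_aux (weight mu).+1; apply: h st _. Qed.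


End Absorb.

Lemma sum_pred (I : finType) (P : pred I) : \sum_x (P x : nat) = #|[set x | P x]|.
Proof. by rewrite -sum1dep_card [RHS]big_mkcond; apply: eq_bigr => x _; case: (P x). Qed.

(** * The starting state of the walk *)

Section Initial.
Variables (A : finType) (tau : A -> bool) (th : A -> A -> A).
Hypothesis dih : dihedral_square tau th.
Variables (m theta w d h : nat).
Hypothesis tau_card : forall k, #|[set x | tau x == k]| = m.
Hypothesis M_lt : 15 * h * #|A| < theta * w.+1.
Hypothesis m_gt : 9 * (theta + (d + 2 * h) + 6) + 8 * w + 6 < m.
Hypothesis d_le : d + 2 * h <= theta + 6.
Variable H : {set edge A}.
Let muH (e : edge A) : nat := e \in H.
Hypothesis H_bal : balanced muH.
Hypothesis H_deg : forall j v, outd muH j v <= h.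
(** The set counts the Latin square triangles at [v] whose edge opposite to [v] is in [H]. *)
Hypothesis H_hits : forall j v, #|[set x | (nx j, x, th v x) \in H]| <= d.

Let U := [set e | [|| e \in H, rot th e \in H | rot th (rot th e) \in H]].
Let mu (e : edge A) : nat := (e \in U) && (e \notin H).
Let hits j v := #|[set x | (nx j, x, th v x) \in H]|.

Let U_rot : rot_closed th U.
Proof.
by move=> e; rewrite !inE (rot3 dih) => /or3P[]->; rewrite ?orbT.
Qed.

Let opp_le j v : \sum_y ((nx (nx j), th v y, v) \in H : nat) <= h.
Proof.
apply: leq_trans (H_deg j v); rewrite -[j in outd _ j]nx3 -H_bal.
by rewrite /ind [leqRHS](reindex_inj (th_injr dih (u := v))).
Qed.

Let ldE j v : outd (fun e => e \in U) j v <= outd muH j v + hits j v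
  + \sum_y ((nx (nx j), th v y, v) \in H : nat).
Proof.
rewrite /hits -sum_pred -!big_split /=; apply: leq_sum => y _.
rewrite inE /muH /= (thC dih).
by do 3!case: (_ \in H).
Qed.

Let out_muE j v : outd mu j v <= hits j v + \sum_y ((nx (nx j), th v y, v) \in H : nat).
Proof.
rewrite /hits -sum_pred -!big_split /=; apply: leq_sum => y _.
rewrite /mu inE /= (thC dih).
by do 3!case: (_ \in H).
Qed.

Let sum_hits j : \sum_v hits j v <= #|A| * h.
Proof.
under eq_bigr do rewrite /hits -sum_pred.
rewrite exchange_big /= -sum_nat_const; apply: leq_sum => x _.
rewrite (reindex_inj (th_injr dih (u := x))) /=.
under eq_bigr do rewrite (thCC dih).
exact: H_deg.
Qed.

Let U_bal : balanced (fun e => e \in U : nat).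
Proof.
move=> j v; rewrite /outd /ind [RHS](reindex_inj (th_injl dih (v := v))) /=.
by apply: eq_bigr => u _; rewrite -[in LHS](rotE dih _ _ _ U_rot).
Qed.

(** The initial load of [v] is its degree in [U]: at most [h] for edges of [H] leaving [v], [h] for
    those entering, [d] for those opposite. Over a part these sum to at most 3h|A|, and [mu] has
    weight at most 6h|A|, so M = 15h|A|. *)
Lemma decomposable_of_few_hits : decomposable H.
Proof.
pose ld j v := #|[set y | (j, v, y) \in U]|.
have ldO j v : ld j v = outd (fun e => e \in U) j v by rewrite /ld -sum_pred.
have UE e : (e \in U : nat) = mu e + muH e.
  by rewrite /mu /muH inE; case: (e \in H); rewrite /= ?andbT ?addn0.
have ld_le j v : ld j v <= d + 2 * h.
  rewrite ldO; apply: leq_trans (ldE j v) _.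
  by move: (H_deg j v) (H_hits j v) (opp_le j v); rewrite /hits; lia.
have out_mu j v : outd mu j v <= d + 2 * h.
  apply: leq_trans (out_muE j v) _.
  by move: (H_hits j v) (opp_le j v); rewrite /hits; lia.
apply: (@absorb A tau th dih m theta w (d + 2 * h) _ tau_card M_lt m_gt H U ld [::] mu).
split=> //.
- by move=> j u k; apply/subset_leq_card/subsetP => v; rewrite !inE => /andP[].
- by move=> e; rewrite /mu; case: (e \in U).
- by move=> e; rewrite cov_nil /mu inE; case: (e \in H) => //=; case: (_ || _).
- move=> j v; have := U_bal j v.
  by rewrite (indD UE) (outdD UE) H_bal => /addIn.
- by move=> j v; move: (ld_le j v) (out_mu j v); lia.
move=> j; have hj : \sum_v outd muH j v <= #|A| * h.
  by rewrite -sum_nat_const; apply: leq_sum => v _.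
have oj k : \sum_v \sum_y ((nx (nx k), th v y, v) \in H : nat) <= #|A| * h.
  by rewrite -sum_nat_const; apply: leq_sum => v _.
have l3 : \sum_v ld j v <= 3 * (#|A| * h).
  apply: leq_trans (_ : \sum_v (outd muH j v + hits j v
    + \sum_y ((nx (nx j), th v y, v) \in H : nat)) <= _).
    by apply: leq_sum => v _; rewrite ldO.
  rewrite !big_split /=; apply: leq_trans (leq_add (leq_add hj (sum_hits j)) (oj j)) _.
  by rewrite !mulSn addn0 addnA.
have w6 : weight mu <= 6 * (#|A| * h).
  have -> : weight mu = \sum_k \sum_v outd mu k v.
    rewrite /weight /outd pair_bigA /= pair_bigA /=.
    by apply: eq_bigr => -[[? ?] ?].
  apply: leq_trans (_ : \sum_(k : 'I_3) 2 * (#|A| * h) <= _).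
    apply: leq_sum => k _.
    apply: leq_trans (_ : \sum_v (hits k v
      + \sum_y ((nx (nx k), th v y, v) \in H : nat)) <= _).
      by apply: leq_sum => v _.
    rewrite big_split /=; apply: leq_trans (leq_add (sum_hits k) (oj k)) _.
    by rewrite !mulSn addn0.
  by rewrite sum_nat_const card_ord mulnA.
move: l3 w6; rewrite mulnAC -mulnA; lia.
Qed.

End Initial.

(** * Relabelling by a random permutation *)

(** Chebyshev's inequality with cleared denominators, for n = k + 1, mean e/n and sum of squares [X]
    over [F] permutations: the variance is at most h + h^2/k <= 2h. *)
Lemma few_arith h k e F D X b : h <= k -> 0 < k -> e <= h * k.+1 ->
  2 * (e * (e * F)) + (k.+1 * D) ^ 2 * b <= k.+1 ^ 2 * X + F * e ^ 2 ->
  k.+1 * k * X <= k * (e * F) + e ^ 2 * F -> D ^ 2 * b <= 2 * h * F.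
Proof.
move=> hk k0 eh h1 h2.
have h3 : e * F <= h * k.+1 * F by rewrite leq_mul2r eh orbT.
have h4 : e ^ 2 <= h * k.+1 * (h * k.+1) by rewrite expnS expn1 leq_mul.
have h5 : e ^ 2 * F <= h * k * (k.+1 * k.+1) * F.
  rewrite leq_mul2r; apply/orP; right; apply: leq_trans h4 _.
  by rewrite mulnACA leq_mul2r leq_mul2l hk !orbT.
have h6 := leq_mul (leqnn (k.+1 * k)) h1.
have h7 := leq_mul (leqnn (k.+1 ^ 2)) h2.
have h8 := leq_mul (leqnn (k.+1 ^ 2 * k)) h3.
have h9 := leq_mul (leqnn k.+1) h5.
have n0 : 0 < k.+1 * k.+1 * k.+1 * k by rewrite !muln_gt0 k0.
rewrite -(leq_pmul2l n0); lia.
Qed.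

Section RandomPermutation.
Variable A : finType.
Implicit Types (x y : A) (s t : {perm A}).
Let n := #|A|.
Let F := #|{perm A}|.

Lemma sum_perm1 x y : n * \sum_(s : {perm A}) (s x == y : nat) = F.
Proof.
have shift y' : \sum_(s : {perm A}) (s x == y : nat) = \sum_(s : {perm A}) (s x == y' : nat).
  rewrite (reindex_inj (mulIg (tperm y y'))) /=; apply: eq_bigr => s _.
  by rewrite permM (canF_eq (tpermK y y')) tpermL.
rewrite -sum_nat_const (eq_bigr _ (fun y' _ => shift y')) exchange_big /=.
rewrite [RHS](_ : _ = \sum_(s : {perm A}) 1); last by rewrite sum1_card.
apply: eq_bigr => s _; rewrite (bigD1 (s x)) //= eqxx big1 // => y' /negbTE h.
by rewrite eq_sym h.
Qed.

Lemma perm_2transitive y1 y1' y2 y2' : y1 != y1' -> y2 != y2' ->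
  exists t, t y1 = y2 /\ t y1' = y2'.
Proof.
move=> h1 h2; exists (tperm y1 y2 * tperm (tperm y1 y2 y1') y2')%g.
rewrite !permM !tpermL tpermD //; last by rewrite eq_sym.
by rewrite -[X in _ != X](tpermL y1 y2) (inj_eq perm_inj) eq_sym.
Qed.

(** By 2-transitivity the sum does not depend on the pair (y, y') of distinct values, and each
    permutation attains exactly one pair. *)
Lemma sum_perm2 x x' y y' : x != x' -> y != y' ->
  n * n.-1 * \sum_(s : {perm A}) (s x == y) * (s x' == y') = F.
Proof.
move=> hx hy.
have shift p : p.1 != p.2 -> \sum_(s : {perm A}) (s x == y) * (s x' == y') =
    \sum_(s : {perm A}) (s x == p.1) * (s x' == p.2).
  move=> hp; have [t [t1 t2]] := perm_2transitive hy hp.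
  rewrite [RHS](reindex_inj (mulIg t)) /=; apply: eq_bigr => s _.
  by rewrite !permM -t1 -t2 !(inj_eq perm_inj).
have cardD : #|[set p : A * A | p.1 != p.2]| = n * n.-1.
  rewrite -sum_pred /= -(pair_bigA _ (fun a b => (a != b : nat))) /=.
  rewrite -sum_nat_const; apply: eq_bigr => a _.
  rewrite sum_pred -(cardC1 a) /n; apply: eq_card => b.
  by rewrite !inE eq_sym.
rewrite -cardD -sum_nat_const.
rewrite (eq_bigr (fun p : A * A => \sum_(s : {perm A}) (s x == p.1) * (s x' == p.2))); last first.
  by move=> p; rewrite inE; exact: shift.
rewrite exchange_big /= [RHS](_ : _ = \sum_(s : {perm A}) 1); last by rewrite sum1_card.
apply: eq_bigr => s _; rewrite (bigD1 (s x, s x')) /=; last by rewrite inE (inj_eq perm_inj).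
rewrite !eqxx big1 // => -[a b] /= /andP[_]; rewrite xpair_eqE.
by rewrite [s x == a]eq_sym [s x' == b]eq_sym; case: eqP; case: eqP.
Qed.

(** * First and second moments *)

Section Moments.
Variable E : A -> A -> bool.
Let N s := \sum_x (E (s x) x : nat).
Let e := \sum_y \sum_x (E y x : nat).

Let NE s : N s = \sum_y \sum_x (E y x) * (s x == y).
Proof.
rewrite exchange_big; apply: eq_bigr => x _.
rewrite (bigD1 (s x)) //= eqxx muln1 big1 ?addn0 // => y /negbTE h.
by rewrite eq_sym h muln0.
Qed.

Lemma moment1 : n * \sum_(s : {perm A}) N s = e * F.
Proof.
rewrite (eq_bigr _ (fun s _ => NE s)) exchange_big big_distrr big_distrl /=.
apply: eq_bigr => y _; rewrite exchange_big big_distrr big_distrl /=.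
apply: eq_bigr => x _; rewrite -big_distrr /= mulnCA; congr (_ * _).
exact: sum_perm1.
Qed.

(** The square expands into pairs of entries of [E]. Equal entries give the first term; distinct
    entries in a common row or column never occur together; the rest is [sum_perm2]. *)
Lemma moment2 : n * n.-1 * \sum_(s : {perm A}) N s ^ 2 <= n.-1 * (e * F) + e ^ 2 * F.
Proof.
have -> : \sum_(s : {perm A}) N s ^ 2 = \sum_(p : A * A) \sum_(q : A * A)
    (E p.1 p.2 * E q.1 q.2) * \sum_(s : {perm A}) (s p.2 == p.1) * (s q.2 == q.1).
  under eq_bigr => s _.
    rewrite NE pair_bigA /= expnS expn1 big_distrl /=.
    under eq_bigr do rewrite big_distrr /=.
    over.
  rewrite exchange_big /=; apply: eq_bigr => p _.
  rewrite exchange_big /=; apply: eq_bigr => q _.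
  by rewrite big_distrr /=; apply: eq_bigr => s _; rewrite mulnACA.
have eE : e = \sum_(p : A * A) (E p.1 p.2 : nat) by rewrite /e pair_bigA.
rewrite big_distrr /=.
apply: leq_trans (_ : \sum_(p : A * A) (n.-1 * (E p.1 p.2 * F)
  + \sum_(q : A * A) E p.1 p.2 * E q.1 q.2 * F) <= _); last first.
  rewrite big_split /= -big_distrr -big_distrl /= -eE leq_add2l.
  rewrite expnS expn1 {1}eE !big_distrl /=; apply: leq_sum => p _.
  by rewrite eE big_distrr big_distrl.
apply: leq_sum => -[y x] _ /=; rewrite (bigD1 (y, x)) //= mulnDr leq_add //.
  case: (E y x); last by rewrite !muln0.
  rewrite !mul1n -(sum_perm1 x y) [n * n.-1]mulnC -mulnA leq_mul // leq_mul //.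
  by apply: leq_sum => s _; case: eqP.
rewrite big_distrr /= [X in _ <= X](bigID (fun q => q != (y, x))) /=.
apply: leq_trans (leq_addr _ _); apply: leq_sum => -[y' x'] /= ne.
rewrite mulnCA leq_mul2l; apply/orP; right.
have [ex|nex] := eqVneq x x'.
  rewrite big1 ?muln0 // => s _; rewrite -ex.
  by case: eqP => // sy; case: eqP => // sy'; move: ne; rewrite -sy -sy' ex eqxx.
have [ey|ney] := eqVneq y y'; last by rewrite sum_perm2.
rewrite big1 ?muln0 // => s _; rewrite -ey.
case: eqP => // sy; case: eqP => // sy'.
by move: nex; rewrite -(inj_eq (@perm_inj _ s)) sy sy' eqxx.
Qed.

Lemma few_large h d : 1 < n -> h <= d -> h <= n.-1 -> e <= h * n ->
  (d.+1 - h) ^ 2 * #|[set s | d < N s]| <= 2 * h * F.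
Proof.
move=> n1 hd hn eh; set D := d.+1 - h.
(* (nN - e)^2 is nonnegative, and at least (nD)^2 if N > d; written without subtraction. *)
have pt s : 2 * (e * (n * N s)) + (n * D) ^ 2 * (d < N s) <= (n * N s) ^ 2 + e ^ 2.
  have [lt|_] := ltnP d (N s); last first.
    by rewrite muln0 addn0 addnC mulnC mulnC; exact: nat_Cauchy.
  have ge : e + n * D <= n * N s.
    apply: leq_trans (leq_add eh (leqnn _)) _; rewrite [h * n]mulnC -mulnDr leq_mul2l.
    by apply/orP; right; rewrite /D; lia.
  rewrite muln1 -(subnKC ge); set k := _ - _; nia.
have S : 2 * (e * (n * \sum_(s : {perm A}) N s)) + (n * D) ^ 2 * #|[set s | d < N s]|
    <= n ^ 2 * (\sum_(s : {perm A}) N s ^ 2) + F * e ^ 2.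
  have E1 : \sum_(s : {perm A}) (2 * (e * (n * N s)) + (n * D) ^ 2 * (d < N s)) =
      2 * (e * (n * \sum_(s : {perm A}) N s)) + (n * D) ^ 2 * #|[set s | d < N s]|.
    by rewrite big_split -!big_distrr sum_pred.
  have E2 : \sum_(s : {perm A}) ((n * N s) ^ 2 + e ^ 2) =
      n ^ 2 * (\sum_(s : {perm A}) N s ^ 2) + F * e ^ 2.
    rewrite big_split sum_nat_const big_distrr /=; congr (_ + _).
    by apply: eq_bigr => s _; rewrite expnMn.
  by rewrite -E1 -E2; apply: leq_sum => s _.
rewrite moment1 in S; have nE : n.-1.+1 = n by lia.
have S2 := moment2; rewrite -{1 2}nE in S; rewrite -{1}nE in S2.
by apply: few_arith S S2; rewrite ?nE //; lia.
Qed.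
End Moments.

End RandomPermutation.

(** Union bound: the permutations that are bad for some [i] do not exhaust all permutations. *)
Lemma spread_perm (A I : finType) (E : I -> A -> A -> bool) h d :
  1 < #|A| -> h <= d -> h <= #|A|.-1 ->
  (forall i, \sum_y \sum_x (E i y x : nat) <= h * #|A|) ->
  2 * h * #|I| < (d.+1 - h) ^ 2 ->
  exists s : {perm A}, forall i, #|[set x | E i (s x) x]| <= d.
Proof.
move=> A1 hd hA hE lt.
pose bad i := [set s : {perm A} | d < \sum_x (E i (s x) x : nat)].
have [s sP|no] := pickP [pred s : {perm A} | [forall i, s \notin bad i]].
  exists s => i; have /forallP/(_ i) := sP.
  by rewrite inE -leqNgt sum_pred.
have F0 : 0 < #|{perm A}| by apply/card_gt0P; exists 1%g.
have : #|{perm A}| <= \sum_i #|bad i|.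
  rewrite -cardsT; apply: leq_trans (_ : #|\bigcup_i bad i| <= _).
    apply/subset_leq_card/subsetP => s _; have /negbT := no s.
    by rewrite negb_forall => /existsP[i]; rewrite negbK => si; apply/bigcupP; exists i.
  elim/big_rec2: _ => [|i X k _ le]; first by rewrite cards0.
  by apply: leq_trans (leq_add (leqnn _) le); rewrite cardsU leq_subr.
rewrite -(leq_pmul2l (leq_trans (ltn0Sn _) lt)) big_distrr /= => le.
have : \sum_i (d.+1 - h) ^ 2 * #|bad i| <= \sum_(i : I) 2 * h * #|{perm A}|.
  by apply: leq_sum => i _; exact: few_large.
move/(leq_trans le); rewrite sum_nat_const mulnA [#|I| * _]mulnC leq_pmul2r //.
by rewrite leqNgt lt.
Qed.

(** * Parts of even size *)

Lemma bijective_of_card (A B : finType) : #|B| = #|A| -> exists g : B -> A, bijective g.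
Proof.
move=> e; exists (fun b => enum_val (cast_ord e (enum_rank b))).
exists (fun a => enum_val (cast_ord (esym e) (enum_rank a))) => x.
  by rewrite enum_valK cast_ordK enum_rankK.
by rewrite enum_valK cast_ordKV enum_rankK.
Qed.

(** * The dihedral group *)

Section Dihedral.
Variable Z : finZmodType.
Local Open Scope ring_scope.

Let sg (s : bool) (a : Z) := if s then - a else a.

(** This is (u v)^-1 for the product (s, a)(t, b) = (s + t, a + (-1)^s b); the boolean marks
    reflections. *)
Definition dihedral_third (u v : bool * Z) : bool * Z :=
  (u.1 (+) v.1, - sg (u.1 (+) v.1) (u.2 + sg u.1 v.2)).

Lemma dihedral_squareP : dihedral_square fst dihedral_third.
Proof.
split=> [[s a] [t b]|[s a] [t b] //|[s a] [t b] [r c]] /=.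
- rewrite /dihedral_third /sg; case: s; case: t => /=; congr pair;
  by rewrite ?GRing.opprK ?GRing.opprB ?GRing.addrK // GRing.addrC GRing.subrK.
case: s; case: t; case: r => //= _; rewrite /dihedral_third /sg /=; congr pair.
- by rewrite -GRing.opprD GRing.opprK GRing.addrA GRing.subrK GRing.opprB.
- by rewrite !GRing.opprK GRing.opprD GRing.addrA GRing.subrK GRing.addrC.
- by rewrite !GRing.opprK GRing.addrA GRing.subrK GRing.addrC.
- by rewrite !GRing.opprK GRing.opprB [(b + c)%R]GRing.addrC GRing.opprD GRing.addrACA
    GRing.subrr GRing.add0r GRing.opprD.
Qed.

Lemma card_dihedral k : #|[set u : bool * Z | u.1 == k]| = #|Z|.
Proof.
rewrite -[RHS](card_imset _ (f := pair k)); last by move=> a b [].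
apply: eq_card => -[s a]; rewrite inE /=; apply/eqP/imsetP => [->|[b _ [-> _]]] //.
by exists a.
Qed.

End Dihedral.

(** * Changing the labels of the parts *)

Section Relabel.
Variables (A B : finType) (f : 'I_3 -> B -> A).
Hypothesis f_bij : forall i, bijective (f i).
Variable H : {set edge A}.

Definition relabel (e : edge B) : edge A :=
  (e.1.1, f e.1.1 e.1.2, f (nx e.1.1) e.2).

Lemma relabel_inj : injective relabel.
Proof.
move=> [[i u] v] [[j x] y] [/= -> ]; have [[g0 K0 _] [g1 K1 _]] := (f_bij j, f_bij (nx j)).
by move/(can_inj K0) => -> /(can_inj K1) ->.
Qed.

Lemma outd_relabel j v : outd (fun e => relabel e \in H) j v = outd (fun e => e \in H) j (f j v).
Proof.
rewrite /outd [RHS](reindex (f (nx j))) //=.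
by have [g K K'] := f_bij (nx j); exists g => x _; [exact: K | exact: K'].
Qed.

Lemma ind_relabel j v :
  ind (fun e => relabel e \in H) j v = ind (fun e => e \in H) j (f (nx j) v).
Proof.
rewrite /ind [RHS](reindex (f j)) //=.
by have [g K K'] := f_bij j; exists g => x _; [exact: K | exact: K'].
Qed.

Lemma decomposable_relabel : decomposable (relabel @^-1: H) -> decomposable H.
Proof.
case=> D covD; exists [seq (T.1.1.1, f T.1.1.1 T.1.1.2, f (nx T.1.1.1) T.1.2,
  f (nx (nx T.1.1.1)) T.2) | T <- D] => -[[j x] y].
have [[g0 K0 K0'] [g1 K1 K1']] := (f_bij j, f_bij (nx j)).
have -> : (j, x, y) = relabel (j, g0 x, g1 y) by rewrite /relabel /= K0' K1'.
have := covD (j, g0 x, g1 y); rewrite inE => <-.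
rewrite /cov big_map; apply: eq_bigr => -[[[i u] v] w] _ /=.
rewrite -!(inj_eq relabel_inj); congr (_ + _).
by rewrite /relabel /= nx3.
Qed.

End Relabel.

Theorem decomposable_even (A : finType) (H : {set edge A}) h :
  ~~ odd #|A| -> 0 < h -> 41 * 1000 * h <= #|A| ->
  balanced (fun e => e \in H) -> (forall j v, outd (fun e => e \in H) j v <= h) ->
  decomposable H.
Proof.
move=> evA h0 hA balH degH; set n := #|A| in evA hA.
pose k := n./2.-1; have nE : n = 2 * k.+1.
  have := odd_double_half n; rewrite (negbTE evA) /k. lia.
pose B := (bool * 'I_k.+1)%type.
have cardB : #|{: B}| = n by rewrite card_prod card_bool card_ord.
have [g g_bij] : exists g : B -> A, bijective g.
  exact: bijective_of_card.
pose th : B -> B -> B := @dihedral_third 'I_k.+1.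
have dih : dihedral_square fst th := dihedral_squareP _.
(* With w <= 21n/1000, the sum 9(n/55 + n/60) + 8w stays below n/2 with room for the constants, and
   (d + 1 - h)^2 exceeds 4hn. *)
pose d := n %/ 60 - 2 * h; pose theta := n %/ 55; pose w := (15 * h * n) %/ theta.
have t1 := leq_trunc_div n 55; have t2 := ltn_ceil n (isT : 0 < 55).
have d1 := leq_trunc_div n 60; have d2 := ltn_ceil n (isT : 0 < 60).
rewrite -/theta in t1 t2.
have theta0 : 0 < theta by rewrite /theta; lia.
have w1 := leq_trunc_div (15 * h * n) theta; have w2 := ltn_ceil (15 * h * n) theta0.
rewrite -/w in w1 w2.
have n0 : 0 < n by lia.
(* As theta >= n/56, w <= 840h, while h <= n/41000. *)
have w3 : 1000 * w <= 21 * n.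
  rewrite leqNgt; apply/negP => lt.
  have h1 : 21 * n * n < 1000 * w * n by rewrite ltn_pmul2r.
  have h2 : 1000 * w * n <= 1000 * w * (56 * theta) by rewrite leq_mul //; lia.
  have : 21 * n * n < 840 * 1000 * h * n.
    apply: leq_trans h1 (leq_trans h2 _).
    by rewrite mulnACA; apply: leq_trans (leq_mul (leqnn _) w1) _; lia.
  by rewrite ltn_pmul2r // => h3; lia.
have d_def : d + 2 * h = n %/ 60 by rewrite /d subnK //; lia.
have balR (f : 'I_3 -> B -> A) : (forall i, bijective (f i)) ->
    balanced (fun e => relabel f e \in H) .
  by move=> f_bij j v; rewrite outd_relabel // ind_relabel // balH.
have degR (f : 'I_3 -> B -> A) : (forall i, bijective (f i)) ->
    forall j v, outd (fun e => relabel f e \in H) j v <= h.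
  by move=> f_bij j v; rewrite outd_relabel.
pose H0 := relabel (fun=> g) @^-1: H.
have deg0 j v : outd (fun e => e \in H0) j v <= h.
  apply: leq_trans (degR (fun=> g) _ j v) => //.
  by apply: leq_sum => x _; rewrite inE.
have sum0 j : \sum_u \sum_v ((j, u, v) \in H0 : nat) <= h * #|{: B}|.
  by rewrite mulnC -sum_nat_const; apply: leq_sum => u _; exact: deg0.
have B1 : 1 < #|{: B}| by lia.
have hd : h <= d by rewrite /d; lia.
have hB : h <= #|{: B}|.-1 by lia.
have big : 2 * h * (2 * n) < (d.+1 - h) ^ 2.
  have : 16 * n <= 1000 * (d.+1 - h) by lia.
  move: (d.+1 - h) => D lD; rewrite ltnNge; apply/negP => le.
  have h1 := leq_mul lD lD; have h2 := leq_mul (leqnn (1000 * 1000)) le.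
  have : 256 * n * n <= 1000 * 1000 * 4 * h * n by lia.
  by rewrite leq_pmul2r //; lia.
pose o : 'I_3 := ord0.
(* Part 0 keeps its labels. Edges opposite to part 1 join parts 2 and 0, so they depend on [p2]
   alone; both other kinds involve [p1], which is chosen second under 2n conditions. *)
have [p2 p2P] : exists s : {perm B}, forall v,
    #|[set x | (nx (nx o), s x, th v x) \in H0]| <= d.
  apply: (@spread_perm B B (fun v y x => (nx (nx o), y, th v x) \in H0) h d) => //.
    move=> v; apply: leq_trans (sum0 (nx (nx o))); apply: leq_sum => y _.
    by rewrite [leqRHS](reindex_inj (th_injr dih (u := v))).
  by apply: leq_ltn_trans big; rewrite leq_mul // cardB; lia.
have [p1 p1P] : exists s : {perm B}, forall i : bool * B, #|[set x |
    if i.1 then (nx o, s x, p2 (th i.2 x)) \in H0 else (o, th x i.2, s x) \in H0]| <= d.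
  apply: (@spread_perm B (bool * B)%type (fun i y x => if i.1
    then (nx o, y, p2 (th i.2 x)) \in H0 else (o, th x i.2, y) \in H0) h d) => //.
    case=> [[] v] /=.
      apply: leq_trans (sum0 (nx o)); apply: leq_sum => y _.
      by rewrite [leqRHS](reindex_inj (inj_comp (@perm_inj _ p2) (th_injr dih (u := v)))).
    apply: leq_trans (sum0 o); rewrite exchange_big /=.
    by rewrite [leqRHS](reindex_inj (th_injl dih (v := v))).
  by rewrite card_prod card_bool cardB.
pose f (i : 'I_3) : B -> A := if i == o then g else if i == nx o then g \o p1 else g \o p2.
have f_bij i : bijective (f i).
  have pb (p : {perm B}) : bijective (g \o p).
    by apply: bij_comp => //; exists p^-1%g; [exact: permK | exact: permKV].
  by rewrite /f; case: ifP => _; last case: ifP => _.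
apply: (decomposable_relabel f_bij).
apply: (@decomposable_of_few_hits B fst th dih k.+1 theta w d h) => //.
- by move=> b; rewrite card_dihedral card_ord.
- by rewrite cardB [theta * _]mulnC.
- rewrite d_def; lia.
- rewrite d_def; lia.
- move=> j v; have := balR f f_bij j v.
  rewrite /ind /outd => e; transitivity (\sum_u (relabel f (j, u, v) \in H : nat)).
    by apply: eq_bigr => x _; rewrite inE.
  by rewrite e; apply: eq_bigr => x _; rewrite inE.
- move=> j v; apply: leq_trans (degR f f_bij j v).
  by apply: leq_sum => x _; rewrite inE.
move=> j v; case: (nxP o j).
- rewrite (eq_card (B := [set x | (nx o, p1 x, p2 (th v x)) \in H0])).
    exact: (p1P (true, v)).
  by move=> x; rewrite !inE /relabel /f /= !nx_neq eqxx.
- rewrite (eq_card (B := [set x | (nx (nx o), p2 x, th v x) \in H0])) //.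
  by move=> x; rewrite !inE /relabel /f /= nx3 !nx_neq eqxx.
(* For [v] in part 2, the substitution x -> th v x gives the second condition on [p1]. *)
rewrite -(card_imset _ (th_injr dih (u := v))).
apply: leq_trans (p1P (false, v)); apply/subset_leq_card/subsetP => _ /imsetP[x + ->].
by rewrite !inE /relabel /f /= nx3 !nx_neq !eqxx /= (thCC dih).
Qed.

(** * Parts of odd size *)

(* A bad pair in an injection with the fewest bad pairs could be removed by
   exchanging two values. *)
Lemma matching_avoiding (A : finType) (bad : rel A) (X Y : {set A}) b :
  #|X| = #|Y| -> 2 * b < #|X| ->
  (forall x, x \in X -> #|[set y in Y | bad x y]| <= b) ->
  (forall y, y \in Y -> #|[set x in X | bad x y]| <= b) ->
  exists f : A -> A, [/\ {in X &, injective f}, f @: X = Y &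
    forall x, x \in X -> ~~ bad x (f x)].
Proof.
move=> cXY bX degX degY.
pose P (f : {ffun A -> A}) := dinjectiveb f X && [forall (x | x \in X), f x \in Y].
pose f0 := [ffun x => nth x (enum Y) (index x (enum X))].
have Pf0 : P f0.
  have lt x : x \in X -> index x (enum X) < size (enum Y).
    by move=> xX; rewrite -cardE -cXY cardE index_mem mem_enum.
  apply/andP; split.
    apply/dinjectiveP => x y xX yX /=; rewrite !ffunE (set_nth_default y) ?lt //.
    move/eqP; rewrite nth_uniq ?lt ?enum_uniq // => /eqP.
    by apply: (index_inj x); rewrite mem_enum.
  by apply/forall_inP => x xX; rewrite ffunE -mem_enum mem_nth ?lt.
pose good (f : {ffun A -> A}) := [set x in X | ~~ bad x (f x)].
case: (@arg_maxnP _ f0 P (fun f => #|good f|) Pf0) => f /andP[/dinjectiveP fI /forall_inP fY] fmax.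
exists f; split=> //.
  apply/eqP; rewrite eqEcard card_in_imset // cXY leqnn andbT.
  by apply/subsetP => _ /imsetP[x xX ->]; exact: fY.
move=> x0 x0X; apply/negP => bad0.
pose X1 := [set x in X | bad x0 (f x)]; pose X2 := [set x in X | bad x (f x0)].
have cX1 : #|X1| <= b.
  apply: leq_trans (degX x0 x0X); rewrite -(card_in_imset (f := f) (D := mem X1)); last first.
    by move=> x y /[!inE] /andP[xX _] /andP[yX _]; exact: fI.
  apply/subset_leq_card/subsetP => _ /imsetP[x + ->].
  by rewrite !inE => /andP[xX ->]; rewrite fY.
have cX2 : #|X2| <= b by exact: degY (fY _ x0X).
have [x1] : exists x, x \in X :\: (X1 :|: X2).
  apply/set0Pn; rewrite -card_gt0 cardsD subn_gt0.
  apply: leq_ltn_trans bX; apply: leq_trans (subset_leq_card (subsetIr _ _)) _.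
  by rewrite cardsU; apply: leq_trans (leq_subr _ _) _; rewrite mul2n -addnn leq_add.
rewrite !inE negb_or => /andP[/andP[+ +] x1X]; rewrite x1X /= => n1 n2.
have x10 : x1 != x0 by apply: contraNneq n1 => ->.
pose g : {ffun A -> A} := [ffun x => f (tperm x0 x1 x)].
have tX x : x \in X -> tperm x0 x1 x \in X by case: tpermP => [->|->|].
have Pg : P g.
  apply/andP; split; last by apply/forall_inP => x xX; rewrite ffunE fY ?tX.
  apply/dinjectiveP => x y xX yX; rewrite !ffunE => /fI e.
  by apply: (@perm_inj _ (tperm x0 x1)); apply: e; rewrite tX.
have := fmax g Pg; rewrite /= leqNgt => /negP; apply; apply: proper_card.
apply/properP; split.
  apply/subsetP => x; rewrite !inE ffunE => /andP[xX gx]; rewrite xX.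
  by case: tpermP => [->|->|_ _] /=.
by exists x0; rewrite !inE x0X ?bad0 // ffunE tpermL.
Qed.

(** * Covering all edges at one vertex *)

Section Star.
Variables (A : finType) (a0 : A).
Implicit Types (j k : 'I_3) (K : {set edge A}).

Lemma bdry_balanced (T : tri A) : balanced (bdry T).
Proof.
case: T => [[[i u] v] w] j x.
have h e : bdry (i, u, v, w) e = unit_edge (i, u, v) e + unit_edge (nx i, v, w) e
   + unit_edge (nx (nx i), w, u) e by [].
rewrite (indD h) (outdD h) !(indD (fun=> erefl)) !(outdD (fun=> erefl)).
rewrite !ind_unit !outd_unit.
have -> : ((nx j, x) == (i, u)) = ((j, x) == (nx (nx i), u)).
  by rewrite -[in LHS](nx3 i) !xpair_eqE (inj_eq nx_inj).
rewrite !xpair_eqE !(inj_eq nx_inj); lia.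
Qed.

Lemma cov_balanced (D : seq (tri A)) : balanced (cov D).
Proof.
move=> j v; rewrite /ind /outd /cov exchange_big [RHS]exchange_big /=.
by apply: eq_bigr => T _; exact: bdry_balanced.
Qed.

(** [K] holds the edges that are missing or already covered, so nothing is left at the vertex [a0]
    of part [k]. *)
Definition isolated K k := (forall w, (k, a0, w) \in K) /\ (forall u, (nx (nx k), u, a0) \in K).

Definition degree_le b K := forall j v,
  (forall w, (j, v, w) \in K) \/ outd (fun e => e \in K) j v <= b.

(** The neighbours of [a0] in the two other parts are equal in number, and a perfect matching
    between them gives triangles through [a0]. The only covered edges not containing this vertex are
    those of the matching, at most one from each vertex of part [nx k], whence the last clause. *)
Lemma isolate K k b :
  balanced (fun e => e \in K) -> degree_le b K -> 3 * b < #|A| ->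
  exists K' D, [/\ forall e, cov D e + (e \notin K') = (e \notin K), isolated K' k,
    degree_le b.+1 K' & forall j v, v != a0 ->
      \sum_(w | w != a0) ((j, v, w) \in K' : nat)
        <= \sum_(w | w != a0) ((j, v, w) \in K : nat) + (j == nx k)].
Proof.
move=> bal deg bA.
pose X := [set v | (k, a0, v) \notin K]; pose Y := [set u | (nx (nx k), u, a0) \notin K].
have outX : outd (fun e => e \in K) k a0 + #|X| = #|A|.
  rewrite /outd sum_pred -(cardsC [set w | (k, a0, w) \in K]).
  by congr (_ + _); apply: eq_card => v; rewrite !inE.
have inY : ind (fun e => e \in K) (nx (nx k)) a0 + #|Y| = #|A|.
  rewrite /ind sum_pred -(cardsC [set u | (nx (nx k), u, a0) \in K]).
  by congr (_ + _); apply: eq_card => v; rewrite !inE.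
have cXY : #|X| = #|Y| by have := bal (nx (nx k)) a0; rewrite nx3; lia.
have [X0|X0] := posnP #|X|.
  exists K, [::]; split=> [e||j v|j v _]; rewrite ?cov_nil ?leq_addr //.
    split=> [w|u].
      by move/eqP: X0; rewrite cards_eq0 => /eqP/setP/(_ w); rewrite !inE => /negbFE.
    by move: X0; rewrite cXY => /eqP; rewrite cards_eq0 => /eqP/setP/(_ u); rewrite !inE => /negbFE.
  by have [h|h] := deg j v; [left | right; apply: leqW].
(* By balance, a vertex without outgoing edges left has no incoming ones either. *)
have iso_out j v w : (forall x, (j, v, x) \in K) -> (nx (nx j), w, v) \in K.
  move=> all_in; apply/negPn/negP => nin.
  have := bal (nx (nx j)) v; rewrite nx3 => e.
  have o : outd (fun e => e \in K) j v = #|A|.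
    by rewrite -sum1_card; apply: eq_bigr => x _; rewrite all_in.
  have : ind (fun e => e \in K) (nx (nx j)) v < #|A|.
    rewrite -sum1_card /ind (bigD1 w) //= [ltnRHS](bigD1 w) //= (negbTE nin) add0n add1n ltnS.
    by apply: leq_sum => x _; case: (_ \in K).
  by rewrite e o ltnn.
have [f [fI fX fK]] : exists f : A -> A, [/\ {in X &, injective f}, f @: X = Y &
    forall x, x \in X -> ~~ ((nx k, x, f x) \in K)].
  apply: (@matching_avoiding A (fun x y => (nx k, x, y) \in K) X Y b) => //.
  - have [all_in|le] := deg k a0; last by lia.
    by have /card_gt0P[x] := X0; rewrite inE all_in.
  - move=> x; rewrite inE => xX.
    have [all_in|] := deg (nx k) x.
      by have := iso_out (nx k) x a0 all_in; rewrite nx3 (negbTE xX).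
    rewrite /outd sum_pred; apply: leq_trans; apply: subset_leq_card.
    by apply/subsetP => y; rewrite !inE => /andP[].
  move=> y; rewrite inE => yY.
  have [all_in|] := deg (nx (nx k)) y; first by rewrite all_in in yY.
  rewrite -bal /ind sum_pred; apply: leq_trans; apply: subset_leq_card.
  by apply/subsetP => x; rewrite !inE => /andP[].
pose D := [seq (k, a0, v, f v) | v <- enum X].
have covD e : cov D e = \sum_(v in X) bdry (k, a0, v, f v) e by rewrite /cov big_map big_enum.
have sum1X (P : pred A) y (Q : bool) : (forall v, v \in X -> P v = Q && (v == y)) ->
    \sum_(v in X) (P v : nat) = Q && (y \in X).
  move=> h; under eq_bigr => v vX do rewrite h //.
  case: Q {h} => /=; last by rewrite big1.
  have [yX|yX] := boolP (y \in X); last first.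
    by rewrite big1 // => v vX; case: eqP => // e; rewrite -e vX in yX.
  by rewrite (bigD1 y) //= eqxx big1 // => v /andP[_ /negbTE->].
have cov0 x y : cov D (k, x, y) = (x == a0) && (y \in X).
  rewrite covD; rewrite -(sum1X (fun v => (x == a0) && (v == y))) //.
  by apply: eq_bigr => v _; rewrite /bdry !xpair_eqE !nx_neq eqxx !addn0 [y == v]eq_sym.
have cov1 x y : cov D (nx k, x, y) = (y == f x) && (x \in X).
  rewrite covD; rewrite -(sum1X (fun v => (v == x) && (y == f v)) x (y == f x)).
    by apply: eq_bigr => v _; rewrite /bdry !xpair_eqE !nx_neq eqxx addn0 add0n [x == v]eq_sym.
  by move=> v _; case: eqP => [->|]; rewrite ?andbT ?andbF.
have cov2 x y : cov D (nx (nx k), x, y) = (y == a0) && (x \in Y).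
  rewrite covD -fX; have [/imsetP[v0 v0X ->]|nx_] := boolP (x \in f @: X).
    rewrite andbT -[y == a0]andbT -[in RHS]v0X.
    rewrite -(sum1X (fun v => (f v0 == f v) && (y == a0)) v0 (y == a0)).
      by apply: eq_bigr => v _; rewrite /bdry !xpair_eqE !nx_neq eqxx !add0n.
    by move=> v vX; rewrite (inj_in_eq fI) // andbC [v0 == v]eq_sym.
  rewrite andbF big1 // => v vX; rewrite /bdry !xpair_eqE !nx_neq eqxx !add0n /=.
  by case: eqP => // e; rewrite e imset_f in nx_.
pose K' := [set e | (e \in K) || (0 < cov D e)].
have KE e : (e \in K' : nat) = (e \in K) + cov D e.
  rewrite inE; case: e => [[j x] y]; case: (nxP k j).
  - rewrite cov0; case: eqP => [->|_]; last by rewrite orbF addn0.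
    by rewrite inE; case: (_ \in K).
  - rewrite cov1; case: eqP => [->|_]; last by rewrite orbF addn0.
    by have [xX|_] := boolP (x \in X); [rewrite (negbTE (fK _ xX)) | rewrite orbF addn0].
  - rewrite cov2; case: eqP => [->|_]; last by rewrite orbF addn0.
    by rewrite inE; case: (_ \in K).
have out1 v : outd (cov D) (nx k) v <= 1.
  rewrite /outd (bigD1 (f v)) //= cov1 eqxx big1 ?addn0 ?leq_b1 // => w /negbTE h.
  by rewrite cov1 h.
have out2 v : outd (cov D) (nx (nx k)) v <= 1.
  rewrite /outd (bigD1 a0) //= cov2 eqxx big1 ?addn0 ?leq_b1 // => w /negbTE h.
  by rewrite cov2 h.
exists K', D; split.
- by move=> e; have := KE e; case: (e \in K') (e \in K) => [] [] /=; lia.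
- split=> [w|u]; rewrite inE.
    by rewrite cov0 eqxx inE; case: (_ \in K).
  by rewrite cov2 eqxx inE; case: (_ \in K).
- move=> j v; have outE := outdD KE j v.
  have [all_in|le] := deg j v; first by left=> w; rewrite inE all_in.
  case: (nxP k j) outE le => outE le.
  + have [->|ne] := eqVneq v a0.
      by left=> w; rewrite inE cov0 eqxx inE; case: (_ \in K).
    right; rewrite outE (_ : outd (cov D) k v = 0) ?addn0; first exact: leqW.
    by rewrite /outd big1 // => w _; rewrite cov0 (negbTE ne).
  + by right; rewrite outE -[b.+1]addn1 leq_add.
  + by right; rewrite outE -[b.+1]addn1 leq_add.
move=> j v va; under eq_bigr do rewrite KE.
rewrite big_split leq_add2l /=; case: (nxP k j); rewrite ?nx_neq ?eqxx /=.
- by rewrite big1 // => w _; rewrite cov0 (negbTE va).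
- by apply: leq_trans (out1 v); rewrite /outd [leqRHS](bigID [pred w | w != a0]) leq_addr.
- by rewrite big1 // => w /negbTE wa; rewrite cov2 wa.
Qed.

End Star.

Lemma balanced_of_cov (A : finType) (K K' : {set edge A}) D :
  (forall e, cov D e + (e \notin K') = (e \notin K)) ->
  balanced (fun e => e \in K) -> balanced (fun e => e \in K').
Proof.
move=> h bal j v.
have E e : (e \in K' : nat) = (e \in K) + cov D e.
  by have := h e; case: (e \in K') (e \in K) => [] [] /=; lia.
by rewrite (indD E) (outdD E) bal cov_balanced.
Qed.

Theorem decomposable_odd (A : finType) (H : {set edge A}) h :
  odd #|A| -> 0 < h -> 41 * 1000 * h.+1 <= #|A|.-1 ->
  balanced (fun e => e \in H) -> (forall j v, outd (fun e => e \in H) j v <= h) ->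
  decomposable H.
Proof.
move=> oA h0 hA balH degH.
have /card_gt0P[a0 _] : 0 < #|A| by lia.
pose o : 'I_3 := ord0.
have b3 : 3 * (h + 2) < #|A| by lia.
have [||K1 [D1 [e1 i1 g1 r1]]] := @isolate A a0 H o h balH; [by move=> j v; right | lia |].
have bal1 := balanced_of_cov e1 balH.
have [|K2 [D2 [e2 i2 g2 r2]]] := @isolate A a0 K1 (nx o) h.+1 bal1 g1; first by lia.
have bal2 := balanced_of_cov e2 bal1.
have [|K3 [D3 [e3 i3 g3 r3]]] := @isolate A a0 K2 (nx (nx o)) h.+2 bal2 g2; first by lia.
have bal3 := balanced_of_cov e3 bal2.
have s12 e : e \in K1 -> e \in K2 by have := e2 e; case: (e \in K1) (e \in K2) => [] [] /=; lia.
have s23 e : e \in K2 -> e \in K3 by have := e3 e; case: (e \in K2) (e \in K3) => [] [] /=; lia.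
have iso j : isolated a0 K3 j.
  case: (nxP o j) => //; split=> x; first by apply/s23/s12/i1.1.
  - by apply/s23/s12/i1.2.
  - by apply/s23/i2.1.
  - by apply/s23/i2.2.
pose B := {x : A | x != a0}.
pose f (e : edge B) : edge A := (e.1.1, val e.1.2, val e.2).
have big_B (F : A -> nat) : \sum_(x : B) F (val x) = \sum_(x | x != a0) F x.
  rewrite [RHS](@reindex_omap _ _ _ A B val insub) => [|x xa]; last by rewrite insubT.
  by apply: eq_bigl => x; rewrite valK eqxx (valP x).
have cardB : #|{: B}| = #|A|.-1.
  by rewrite card_sig -(cardC1 a0); apply: eq_card => x; rewrite !inE.
have sumB (F : A -> nat) : F a0 = 1 -> (\sum_(x : B) F (val x)).+1 = \sum_x F x.
  by move=> F1; rewrite big_B [RHS](bigD1 a0) //= F1.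
(* All edges at the three copies of [a0] are in [K3], so deleting these vertices lowers every degree
   by exactly 1. *)
have balB : balanced (fun e => e \in f @^-1: K3).
  move=> j v; rewrite /ind /outd; apply: succn_inj.
  under eq_bigr do rewrite inE /f /=.
  under [in RHS]eq_bigr do rewrite inE /f /=.
  rewrite (sumB (fun u => (j, u, val v) \in K3 : nat)); last by rewrite (iso j).1.
  rewrite (sumB (fun w => (nx j, val v, w) \in K3 : nat)); last by rewrite -[nx j]nx3 (iso _).2.
  exact: bal3.
(* For each [j], only one of the three rounds adds an edge avoiding [a0], and at most one at [v]. *)
have degB j v : outd (fun e => e \in f @^-1: K3) j v <= h.+1.
  rewrite /outd; under eq_bigr do rewrite inE /f /=.
  rewrite (big_B (fun w => (j, val v, w) \in K3 : nat)).
  have va := valP v; have := r1 j _ va; have := r2 j _ va; have := r3 j _ va.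
  have : \sum_(w | w != a0) ((j, val v, w) \in H : nat) <= h.
    by apply: leq_trans (degH j (val v)); rewrite /outd [leqRHS](bigID [pred w | w != a0]) leq_addr.
  by case: (nxP o j); rewrite ?nx3 !nx_neq ?eqxx /=; lia.
have [DB covB] : decomposable (f @^-1: K3).
  apply: (@decomposable_even B _ h.+1) => //; rewrite cardB //.
  by move: oA; case: #|A| => [|n] //=.
exists (D1 ++ D2 ++ D3 ++ [seq (T.1.1.1, val T.1.1.2, val T.1.2, val T.2) | T <- DB]) => e.
rewrite !cov_cat -e1 -e2 -e3 !addnA; congr (_ + _ + _ + _).
have vF (x : B) : (a0 == val x) = false by rewrite eq_sym; apply/negbTE/(valP x).
rewrite /cov big_map; case: e => [[j x] y].
have [->|xa] := eqVneq x a0.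
  rewrite (iso j).1 big1 // => -[[[i u] v] w] _.
  by rewrite /bdry /= !xpair_eqE !vF !andbF.
have [->|ya] := eqVneq y a0.
  have := (iso (nx j)).2 x; rewrite nx3 => ->; rewrite big1 // => -[[[i u] v] w] _.
  by rewrite /bdry /= !xpair_eqE !vF !andbF.
have -> : (j, x, y) = f (j, Sub x xa, Sub y ya) by [].
have f_inj : injective f.
  by move=> [[i u] v] [[k x'] y'] [-> /val_inj-> /val_inj->].
have := covB (j, Sub x xa, Sub y ya); rewrite inE => <-.
apply: eq_bigr => -[[[i u] v] w] _ /=.
by rewrite -!(inj_eq f_inj).
Qed.

(** * From labelled parts to graphs *)

(** The cyclic Latin square u + v + w = 0 works for every size; this serves the case without missing
    edges, where [n] may be small. *)
Lemma decomposable_set0 (A : finType) : decomposable (set0 : {set edge A}).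
Proof.
have [A0|A0] := posnP #|A|.
  by exists [::] => -[[j x] y]; have := fintype0 x A0.
pose Z := 'I_(#|A|.-1).+1.
have [g g_bij] : exists g : Z -> A, bijective g.
  by apply: bijective_of_card; rewrite card_ord prednK.
apply: (@decomposable_relabel A Z (fun=> g)) => //.
pose th (u v : Z) := (- (u + v))%R.
have thZ : semisymmetric th.
  by move=> u v; rewrite /th GRing.opprD GRing.addrC GRing.opprK GRing.addrK.
have [|D covD] := cov_latin thZ (U := set0); first by move=> E; rewrite inE.
by exists D => e; rewrite covD !inE.
Qed.

Section Graph.
Variables (T : finType) (e : rel T) (V : 'I_3 -> {set T}) (n : nat).
Hypotheses (e_sym : symmetric e) (V_parts : tripartition e V).
Variable f : 'I_3 -> 'I_n -> T.
Hypothesis f_inj : forall i, injective (f i).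
Hypothesis f_img : forall i, f i @: setT = V i.

Definition missing : {set edge 'I_n} :=
  [set E | ~~ e (f E.1.1 E.1.2) (f (nx E.1.1) E.2)].

Definition ends (E : edge 'I_n) : {set T} := [set f E.1.1 E.1.2; f (nx E.1.1) E.2].

Definition corners (t : tri 'I_n) : {set T} :=
  [set f t.1.1.1 t.1.1.2; f (nx t.1.1.1) t.1.2; f (nx (nx t.1.1.1)) t.2].

Lemma f_in i x : f i x \in V i.
Proof. by rewrite -f_img imset_f. Qed.

Lemma f_eq i x j y : (f i x == f j y) = ((i, x) == (j, y)).
Proof.
rewrite xpair_eqE; have [<-|ne] /= := eqVneq i j; first by rewrite (inj_eq (@f_inj i)).
have [_ dis _] := V_parts; apply/eqP => h.
by have := disjointFr (dis i j ne) (f_in i x); rewrite h f_in.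
Qed.

Lemma f_surj x : exists i y, x = f i y.
Proof.
have [cov _ _] := V_parts; have : x \in [set: T] by [].
rewrite -cov => /bigcupP[i _]; rewrite -f_img => /imsetP[y _ ->].
by exists i, y.
Qed.

Lemma ends_inj : injective ends.
Proof.
move=> [[i x] y] [[j u] v] h.
have /set2P[/eqP|/eqP] : f i x \in ends (j, u, v) by rewrite -h set21.
all: have /set2P[/eqP|/eqP] : f (nx i) y \in ends (j, u, v) by rewrite -h set22.
all: rewrite !f_eq /= !xpair_eqE => /andP[/eqP e1 /eqP e2] /andP[/eqP e3 /eqP e4].
- by move: e1; rewrite -e3 => /eqP; rewrite nx_neq.
- by rewrite e2 e3 e4.
- by move: e1; rewrite e3 => /eqP; rewrite nx_neq.
- by move: e1; rewrite e3 => /eqP; rewrite nx_neq.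
Qed.

Lemma card_ends E : #|ends E| = 2.
Proof.
by case: E => [[i x] y]; rewrite cards2 f_eq xpair_eqE /= nx_neq.
Qed.

Lemma ends_adj E : E \notin missing -> {in ends E &, forall x y, x != y -> e x y}.
Proof.
rewrite inE negbK => adj x y /set2P[]-> /set2P[]->; rewrite ?eqxx //.
by rewrite e_sym.
Qed.

Lemma adj_ends x y : e x y -> exists2 E, E \notin missing & [set x; y] = ends E.
Proof.
move=> xy; have [i [u xE]] := f_surj x; have [j [v yE]] := f_surj y.
case: (nxP i j) yE => yE.
- have [_ _ /(_ i x y)] := V_parts; rewrite xE yE !f_in => /(_ isT isT).
  by rewrite -xE -yE xy.
- by exists (i, u, v); rewrite ?inE /ends /= -xE -yE ?negbK.
exists (nx (nx i), v, u); rewrite ?inE /ends /= nx3 -xE -yE ?negbK 1?e_sym //.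
by rewrite setUC.
Qed.

Lemma ends_bdry t E : 0 < bdry t E -> ends E \in triangle_edges (corners t).
Proof.
move=> h; rewrite inE card_ends eqxx andbT subUset !sub1set.
case: t h => [[[i u] v] w]; rewrite /bdry /corners /=.
case: eqP => [-> _|_] /=; first by rewrite !inE !eqxx ?orbT.
case: eqP => [-> _|_] /=; first by rewrite !inE !eqxx ?orbT.
by case: eqP => [-> _|_] //=; rewrite nx3 !inE !eqxx ?orbT.
Qed.

Lemma corners_ends t x y : x \in corners t -> y \in corners t -> x != y ->
  exists2 E, 0 < bdry t E & [set x; y] = ends E.
Proof.
case: t => [[[i u] v] w]; rewrite /corners /= => xT yT xy.
have b0 : 0 < bdry (i, u, v, w) (i, u, v) by rewrite /bdry eqxx.
have b1 : 0 < bdry (i, u, v, w) (nx i, v, w) by rewrite /bdry eqxx addnC addnA addn1.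
have b2 : 0 < bdry (i, u, v, w) (nx (nx i), w, u) by rewrite /bdry eqxx addn1.
have e2 : ends (nx (nx i), w, u) = [set f (nx (nx i)) w; f i u] by rewrite /ends /= nx3.
move: xT yT xy; rewrite !inE -!orbA => /or3P[]/eqP-> /or3P[]/eqP->; rewrite ?eqxx // => _.
- by exists (i, u, v).
- by exists (nx (nx i), w, u) => //; rewrite e2 setUC.
- by exists (i, u, v) => //; rewrite setUC.
- by exists (nx i, v, w).
- by exists (nx (nx i), w, u).
- by exists (nx i, v, w) => //; rewrite setUC.
Qed.

Lemma card_corners t : #|corners t| = 3.
Proof.
case: t => [[[i u] v] w]; rewrite /corners setUC cardsU1 cards2 !inE !f_eq !xpair_eqE /=.
by rewrite !nx_neq.
Qed.

(** [ends] matches the labelled edges outside [missing] with the edges of the graph, and covering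
    each exactly once makes the edge sets of the triangles a partition. *)
Lemma graph_decomposition : decomposable missing -> exists D, triangle_decomposition e D.
Proof.
case=> D covD; have in_cov t E : t \in D -> 0 < bdry t E -> E \notin missing.
  move=> tD h; have := covD E; rewrite /cov (big_rem t tD) /=.
  by case: (E \in missing) => //=; lia.
exists [set corners t | t in D]; split.
  move=> _ /imsetP[t tD ->]; split; first exact: card_corners.
  move=> x y xt yt xy; have [E bE xyE] := corners_ends xt yt xy.
  by apply: (ends_adj (in_cov _ _ tD bE)) => //; rewrite -xyE ?set21 ?set22.
have edgeP B t : B \in triangle_edges (corners t) -> exists2 E, 0 < bdry t E & B = ends E.
  rewrite inE => /andP[/subsetP sB /cards2P[x [y [xy BE]]]].
  rewrite BE; apply: corners_ends xy; apply: sB; rewrite BE ?set21 ?set22 //.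
apply/and3P; split.
- apply/eqP/setP => B; apply/bigcupP/imsetP.
    case=> _ /imsetP[_ /imsetP[t tD ->] ->] /edgeP[E bE ->].
    have := in_cov _ _ tD bE; case: E {bE} => [[i u] v]; rewrite inE negbK => adj.
    by exists (f i u, f (nx i) v); rewrite ?inE.
  case=> -[x y]; rewrite inE => /adj_ends[E nE h] ->; rewrite h.
  have : 0 < cov D E by rewrite covD nE.
  rewrite /cov big_seq lt0n sum_nat_seq_neq0 => /hasP[t tD /andP[_ bt]].
  exists (triangle_edges (corners t)); first by rewrite !imset_f.
  by apply: ends_bdry; rewrite lt0n.
- apply/trivIsetP => _ _ /imsetP[_ /imsetP[t tD ->] ->] /imsetP[_ /imsetP[t' tD' ->] ->].
  apply: contraR => /pred0Pn[B /andP[/= /edgeP[E bE ->] /edgeP[E' bE' /ends_inj eE]]].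
  rewrite -{}eE in bE'; have [->//|ne] := eqVneq t t'.
  (* Two different triangles of [D] containing [E] would cover it twice. *)
  have := covD E; rewrite /cov (big_rem t tD) /= (big_rem t') /=; last first.
    by rewrite rem_mem // eq_sym.
  by case: (E \in missing) => /=; lia.
apply/imsetP => -[_ /imsetP[[[[i u] v] w] _ ->]] /setP/(_ (ends (i, u, v))).
by rewrite ends_bdry ?inE // /bdry eqxx.
Qed.

End Graph.

Lemma field_decomposition (n : nat) (H : {set edge 'I_n}) :
  balanced (fun E => E \in H) ->
  (forall j v, 83 * 1000 * outd (fun E => E \in H) j v <= n) -> decomposable H.
Proof.
move=> bal deg.
pose h := \max_(p : 'I_3 * 'I_n) outd (fun E => E \in H) p.1 p.2.
have le_h j v : outd (fun E => E \in H) j v <= h.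
  exact: (leq_bigmax (F := fun p => outd (fun E => E \in H) p.1 p.2) (j, v)).
have h_le : 83 * 1000 * h <= n.
  rewrite /h; elim/big_rec: _ => [|p k _ IH]; first by rewrite muln0.
  by rewrite maxnMr geq_max deg.
have [h0|h0] := posnP h.
  rewrite (_ : H = set0); first exact: decomposable_set0.
  apply/setP => -[[j u] v]; rewrite inE; apply/negP => uvH.
  by have := le_h j u; rewrite h0 /outd (bigD1 v) //= uvH.
have [oddn|evenn] := boolP (odd n).
  (* As h >= 1, 41000(h + 1) <= 82000h <= n - 1. *)
  have hO : 41 * 1000 * h.+1 <= #|'I_n|.-1 by rewrite card_ord; lia.
  by apply: (decomposable_odd _ h0 hO bal le_h); rewrite card_ord.
have hE : 41 * 1000 * h <= #|'I_n| by rewrite card_ord; lia.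
by apply: (decomposable_even _ h0 hE bal le_h); rewrite card_ord.
Qed.

Import Order.TTheory GRing.Theory Num.Theory.
Local Open Scope ring_scope.

Theorem theorem5p1p4 (R : realType) (eps : R)
    (eps_ge0 : 0 <= eps) (eps_lt : eps < 1197 / 1000 * 10 ^- 5)
    (T : finType) (e : rel T) (e_sym : symmetric e) (e_irr : irreflexive e)
    (V : 'I_3 -> {set T}) (V_parts : tripartition e V)
    (n : nat) (V_card : forall i : 'I_3, #|V i| = n)
    (V_deg : forall (i : 'I_3) (v : T), v \in V i ->
       deg_plus e V i v = deg_minus e V i v /\
       (1 - eps) * n%:R <= (deg_minus e V i v)%:R) :
  exists D : {set {set T}}, triangle_decomposition e D.
Proof.
pose f i (x : 'I_n) : T := enum_val (cast_ord (esym (V_card i)) x).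
have f_inj i : injective (f i) by move=> x y /enum_val_inj/cast_ord_inj.
have f_img i : f i @: setT = V i.
  apply/eqP; rewrite eqEcard card_imset // cardsT card_ord V_card leqnn andbT.
  by apply/subsetP => _ /imsetP[x _ ->]; exact: enum_valP.
have degE j v : (deg_in e (V j) v + \sum_w (~~ e v (f j w) : nat) = n)%N.
  rewrite sum_pred /deg_in -[RHS]card_ord -(cardsC [set w | e v (f j w)]).
  congr (_ + _)%N; last by apply: eq_card => w; rewrite !inE.
  rewrite -(card_imset _ (@f_inj j)); apply: eq_card => x; rewrite !inE -f_img.
  apply/andP/imsetP => [[/imsetP[w _ ->] vw]|[w + ->]]; first by exists w; rewrite ?inE.
  by rewrite inE imset_f.
apply: (graph_decomposition e_sym V_parts f_inj f_img).
have outE j v : (deg_plus e V j (f j v) + outd (fun E => E \in missing e f) j v = n)%N.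
  rewrite /deg_plus -nxE -[RHS](degE (nx j) (f j v)); congr (_ + _)%N.
  by apply: eq_bigr => w _; rewrite inE.
have inE' j v : (deg_minus e V (nx j) (f (nx j) v) + ind (fun E => E \in missing e f) j v = n)%N.
  rewrite /deg_minus nxE addrK -nxE -[RHS](degE j (f (nx j) v)); congr (_ + _)%N.
  by apply: eq_bigr => w _; rewrite inE /= e_sym.
have fV i v : f i v \in V i by rewrite -f_img imset_f.
apply: field_decomposition => [j v|j v].
  have [d _] := V_deg _ _ (fV (nx j) v).
  by have := inE' j v; have := outE (nx j) v; rewrite d; lia.
have [d le] := V_deg _ _ (fV j v); have out := outE j v; rewrite d in out.
rewrite -(ler_nat R) !natrM.
have out' : (deg_minus e V j (f j v))%:R + (outd (fun E => E \in missing e f) j v)%:R = n%:R :> R.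
  by rewrite -natrD out.
have n0 : 0 <= n%:R :> R by rewrite ler0n.
(* At most eps n edges are missing at a vertex on each side, and 83000 times 1.197 * 10^-5 is below
   1. *)
have := ler_wpM2r n0 (ltW eps_lt).
lra.
Qed.
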